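(* Let $\mathfrak g$ be a finite-dimensional Lie algebra over a field $\mathbb K$ of characteristic zero. Viewed as a formal power series function of $x\in\mathfrak g$, the element $\Omega\in S(\mathfrak g^* )^\wedge$ is $$\Omega(x)=\exp\left(\sum_{n\ge1}2c_{2n}\operatorname{Tr}\left((\operatorname{ad}_x)^{2n}\right)\right)=\operatorname{det}^{1/2}\left(\frac{\sinh(\operatorname{ad}_x/2)}{\operatorname{ad}_x/2}\right),$$ and the Duflo map $\mathcal D: S(\mathfrak g)^{\mathfrak g}\to U(\mathfrak g)^{\mathfrak g}$ is given by $$\mathcal D(P)=\mathcal S\left(\Omega(\partial)P\right)\qquad\text{for all }P\in S(\mathfrak g)^{\mathfrak g}.$$ Here $\mathcal S: S(\mathfrak g)\to U(\mathfrak g)$ is the Poincaré–Birkhoff–Witt symmetrization map $\mathcal S(x_1\cdots x_d)=\frac1{d!}\sum_{\sigma\in S_d}x_{\sigma(1)}\cdots x_{\sigma(d)}$, and $\Omega(\partial)$ is the (infinite order) constant-coefficient differential operator on $S(\mathfrak g)$ obtained from $\Omega$, written as a power series in $b_1^*,\dots,b_m^*$, by replacing each $b_i^*$ with $\partial_i=\partial/\partial b_i$.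
   Context: Let $\mathbb K$ be a field of characteristic zero and $\mathfrak g$ a finite-dimensional Lie algebra over $\mathbb K$ with basis $b_1,\dots,b_m$, dual basis $b_1^*,\dots,b_m^*$ of $\mathfrak g^*$, and structure constants $[b_i,b_j]=\sum_k c_{ij}^k b_k$. $S$ denotes the symmetric algebra and $U(\mathfrak g)$ the universal enveloping algebra; $S(\mathfrak g)^{\mathfrak g}$ and $U(\mathfrak g)^{\mathfrak g}$ are the subalgebras of invariants for the adjoint action. $S(\mathfrak g)$ is regarded as the polynomial algebra in $b_1,\dots,b_m$. Elements of $S(\mathfrak g^* )$ are regarded as polynomial functions on $\mathfrak g$ via $(\varphi_1\cdots\varphi_k)(x)=\varphi_1(x)\cdots\varphi_k(x)$, and elements of $S(\mathfrak g^* )^\wedge$ as formal power series on $\mathfrak g$. $\mathfrak g$ acts on $S(\mathfrak g^* )$ by derivations extending the coadjoint action $(x\cdot\varphi)(y)=-\varphi([x,y])$, and $S(\mathfrak g^* )_{\mathfrak g}$ is the space of coinvariants, i.e. the quotient of $S(\mathfrak g^* )$ by the span of all $x\cdot f$, $x\in\mathfrak g$, $f\in S(\mathfrak g^* )$. The symbol $^\wedge$ denotes degree completion (direct product of graded pieces), where elements of $\mathfrak g^*$ have degree $1$ and elements of $\mathfrak g$ have degree $0$. Pairing: $\langle \varphi_1\cdots\varphi_k, x_1\cdots x_k\rangle=\sum_{\sigma\in S_k}\varphi_1(x_{\sigma(1)})\cdots\varphi_k(x_{\sigma(k)})$ for $\varphi_i\in\mathfrak g^*$, $x_j\in\mathfrak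 g$; monomials of different degrees pair to zero; extended bilinearly to $S(\mathfrak g^* )\times S(\mathfrak g)\to\mathbb K$. It descends to a pairing $S(\mathfrak g^* )_{\mathfrak g}\times S(\mathfrak g)^{\mathfrak g}\to\mathbb K$. The elements $\Omega$ and $\Upsilon$: let $\iota=\sum_{i=1}^m b_i^*\otimes b_i\in\mathfrak g^*\otimes\mathfrak g$ and $e^\iota=\sum_{d\ge0}\iota^d/d!\in (S(\mathfrak g^* )\otimes U(\mathfrak g))^\wedge$, powers being taken in the algebra $S(\mathfrak g^* )\otimes U(\mathfrak g)$. For $n\ge 1$ let $$W_{2n}=\sum c_{k_0e_1}^{k_1}c_{k_1e_2}^{k_2}\cdots c_{k_{2n-1}e_{2n}}^{k_0}\; b_{e_1}^*b_{e_2}^*\cdots b_{e_{2n}}^*\in S(\mathfrak g^* ),$$ where the sum is over all indices $k_0,\dots,k_{2n-1},e_1,\dots,e_{2n}\in\{1,\dots,m\}$. Define $c_{2n}\in\mathbb Q$ by the power series identity $\sum_{n\ge1}c_{2n}x^{2n}=\frac14\log\frac{\sinh(x/2)}{x/2}$, and let $\Omega=\exp\left(\sum_{n\ge1}2c_{2n}W_{2n}\right)\in S(\mathfrak g^* )^\wedge$. Then $\Upsilon\in (S(\mathfrak g^* )_{\mathfrak g}\otimes U(\mathfrak g))^\wedge$ is the image of $e^\iota\cdot(\Omega\otimes 1)$ under the quotient map $S(\mathfrak g^* )\to S(\mathfrak g^* )_{\mathfrak g}$ in the first factor. Duflo map: for $P\in S(\mathfrak g)^{\mathfrak g}$, $\mathcal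 D(P)=\langle\Upsilon,P\rangle\in U(\mathfrak g)$ is obtained by pairing $P$ with the first tensor factor of $\Upsilon$ (only finitely many degrees of $\Upsilon$ contribute). The values of $\mathcal D$ lie in $U(\mathfrak g)^{\mathfrak g}$. Notation: $\frac{\sinh(A/2)}{A/2}=\sum_{k\ge0}\frac{A^{2k}}{4^k(2k+1)!}$, and $\det^{1/2}$ denotes the square root, with constant term $1$, of the determinant, as a formal power series on $\mathfrak g$. *)

(* Defs.v *)
From HB Require Import structures.
From mathcomp Require Import all_boot all_order all_algebra perm.
From mathcomp Require Import ssrcomplements mpoly.
From mathcomp Require Import boolp.

Set Implicit Arguments.
Unset Strict Implicit.
Unset Printing Implicit Defensive.

Import GRing.Theory.
Local Open Scope quotient_scope.
Local Open Scope ring_scope.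

(* Formal power series in n commuting variables, with coefficients in a
   possibly noncommutative ring R with which the variables commute, so that
   mseries n R is the degree completion of {mpoly R[n]}.  *)
Record mseries (n : nat) (R : nzRingType) :=
  MSeries { scoef : 'X_{1..n} -> R }.

HB.instance Definition _ n R := gen_eqMixin (mseries n R).
HB.instance Definition _ n R := gen_choiceMixin (mseries n R).

Section MSeriesRing.
Context {n : nat} {R : nzRingType}.
Implicit Types f g h : mseries n R.

Lemma mseriesP f g : (forall M, scoef f M = scoef g M) -> f = g.
Proof. by case: f g => f [g] /= /funext ->. Qed.

Definition mser_poly (p : {mpoly R[n]}) : mseries n R :=
  MSeries (fun M => p@_M).
Definition mser_opp f := MSeries (fun M => - scoef f M).
Definition mser_add f g := MSeries (fun M => scoef f M + scoef g M).
Definition mser_scale (c : R) f := MSeries (fun M => c * scoef f M).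
Definition mser_mul f g : mseries n R :=
  MSeries (fun M =>
    \sum_(k : 'X_{1..n < (mdeg M).+1, (mdeg M).+1} | M == (k.1 + k.2)%MM)
       scoef f k.1 * scoef g k.2).

Fact mser_addA : associative mser_add.
Proof. by move=> f g h; apply: mseriesP => M /=; rewrite addrA. Qed.
Fact mser_addC : commutative mser_add.
Proof. by move=> f g; apply: mseriesP => M /=; rewrite addrC. Qed.
Fact mser_add0 : left_id (mser_poly 0) mser_add.
Proof. by move=> f; apply: mseriesP => M /=; rewrite mcoeff0 add0r. Qed.
Fact mser_addN : left_inverse (mser_poly 0) mser_opp mser_add.
Proof. by move=> f; apply: mseriesP => M /=; rewrite mcoeff0 addNr. Qed.

HB.instance Definition _ := GRing.isZmodule.Build (mseries n R)
  mser_addA mser_addC mser_add0 mser_addN.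

Let trunc d f : {mpoly R[n]} :=
  \sum_(k : 'X_{1..n < d}) scoef f k *: 'X_[k].

Let truncE d f M : (mdeg M < d)%N -> (trunc d f)@_M = scoef f M.
Proof.
move=> ltMd; rewrite /trunc linear_sum /= (bigD1 (BMultinom ltMd)) //=.
rewrite mcoeffZ mcoeffX eqxx mulr1 big1 ?addr0 // => k neq_k.
rewrite mcoeffZ mcoeffX; case: eqP => [eqkM|_]; last by rewrite mulr0.
by case/eqP: neq_k; apply: val_inj.
Qed.

Let mulE (p q : {mpoly R[n]}) f g M :
    (forall k, (mdeg k <= mdeg M)%N -> p@_k = scoef f k) ->
    (forall k, (mdeg k <= mdeg M)%N -> q@_k = scoef g k) ->
  scoef (mser_mul f g) M = (p * q)@_M.
Proof.
move=> pf qg; rewrite /= mcoeffM; apply: eq_bigr => -[k1 k2] /= _.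
by rewrite pf ?qg // -ltnS bmdeg.
Qed.

Let mul_trunc f g M :
  scoef (mser_mul f g) M =
  (trunc (mdeg M).+1 f * trunc (mdeg M).+1 g)@_M.
Proof. by apply: mulE => k lek; rewrite truncE // ltnS. Qed.

Let mul_trunc_le f g d M : (mdeg M < d)%N ->
  (trunc d f * trunc d g)@_M = scoef (mser_mul f g) M.
Proof.
by move=> ltMd; rewrite -(@mulE _ _ f g) // => k lek;
   rewrite truncE // (leq_ltn_trans lek).
Qed.

Fact mser_mulA : associative mser_mul.
Proof.
move=> f g h; apply: mseriesP => M.
set d := (mdeg M).+1.
rewrite (@mulE (trunc d f) (trunc d g * trunc d h)); first last.
- by move=> k lek; rewrite mul_trunc_le.
- by move=> k lek; rewrite truncE.
rewrite (@mulE (trunc d f * trunc d g) (trunc d h)) ?mulrA //.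
- by move=> k lek; rewrite mul_trunc_le.
- by move=> k lek; rewrite truncE.
Qed.

Fact mser_mul1 : left_id (mser_poly 1) mser_mul.
Proof.
move=> f; apply: mseriesP => M.
rewrite (@mulE 1 (trunc (mdeg M).+1 f)) ?mul1r ?truncE //.
by move=> k lek; rewrite truncE.
Qed.

Fact mser_mulr1 : right_id (mser_poly 1) mser_mul.
Proof.
move=> f; apply: mseriesP => M.
rewrite (@mulE (trunc (mdeg M).+1 f) 1) ?mulr1 ?truncE //.
by move=> k lek; rewrite truncE.
Qed.

Fact mser_mulDl : left_distributive mser_mul +%R.
Proof.
move=> f g h; apply: mseriesP => M /=; rewrite -big_split /=.
by apply: eq_bigr => k _; rewrite mulrDl.
Qed.

Fact mser_mulDr : right_distributive mser_mul +%R.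
Proof.
move=> f g h; apply: mseriesP => M /=; rewrite -big_split /=.
by apply: eq_bigr => k _; rewrite mulrDr.
Qed.

Fact mser_1neq0 : mser_poly 1 != 0.
Proof.
apply/eqP => /(congr1 (fun f => scoef f 0%MM)) /=.
by rewrite mcoeff1 mcoeff0 eqxx => /eqP; rewrite oner_eq0.
Qed.

HB.instance Definition _ := GRing.Zmodule_isNzRing.Build (mseries n R)
  mser_mulA mser_mul1 mser_mulr1 mser_mulDl mser_mulDr mser_1neq0.

Fact mser_scaleA a b f : mser_scale a (mser_scale b f) = mser_scale (a * b) f.
Proof. by apply: mseriesP => M /=; rewrite mulrA. Qed.
Fact mser_scale1 : left_id 1 mser_scale.
Proof. by move=> f; apply: mseriesP => M /=; rewrite mul1r. Qed.
Fact mser_scaleDr : right_distributive mser_scale +%R.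
Proof. by move=> a f g; apply: mseriesP => M /=; rewrite mulrDr. Qed.
Fact mser_scaleDl f : {morph mser_scale^~ f : a b / a + b}.
Proof. by move=> a b; apply: mseriesP => M /=; rewrite mulrDl. Qed.

HB.instance Definition _ := GRing.Zmodule_isLmodule.Build R (mseries n R)
  mser_scaleA mser_scale1 mser_scaleDr mser_scaleDl.

End MSeriesRing.

Section MSeriesComRing.
Context {n : nat} {R : comNzRingType}.

Fact mser_mulC : commutative (@mser_mul n R).
Proof.
move=> f g; apply: mseriesP => M /=.
pose swap (T : Type) (k : T * T) := (k.2, k.1).
have swapK T : involutive (@swap T) by case.
rewrite (reindex_inj (inv_inj (swapK _))) /=.
by apply: eq_big => k; rewrite ?[(k.2 + k.1)%MM]addmC // mulrC.
Qed.

HB.instance Definition _ :=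
  GRing.PzRing_hasCommutativeMul.Build (mseries n R) mser_mulC.

End MSeriesComRing.

(* The sum F_a + F_{a+1} + ... .  It is only used when F_k has no term of
   degree less than k, so that the truncation at k <= mdeg M drops only
   vanishing contributions to the coefficient of M.  *)
Definition mser_sum {n} {R : nzRingType} (a : nat) (F : nat -> mseries n R) :
    mseries n R :=
  MSeries (fun M => \sum_(a <= k < (mdeg M).+1) scoef (F k) M).

(* exp f, for f with zero constant term.  *)
Definition mser_exp {n} {K : fieldType} (f : mseries n K) : mseries n K :=
  mser_sum 0 (fun k => (k`!%:R)^-1 *: f ^+ k).

(* log f, for f with constant term 1.  *)
Definition mser_log {n} {K : fieldType} (f : mseries n K) : mseries n K :=
  mser_sum 1 (fun k => ((-1) ^+ k.+1 / k%:R) *: (f - 1) ^+ k).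

(* s = f^{1/2}, the square root with constant term 1.  *)
Definition mser_is_sqrt {n} {K : fieldType} (s f : mseries n K) : Prop :=
  scoef s 0%MM = 1 /\ s ^+ 2 = f.

(* The coefficient 1 / (4^k (2k+1)!) of A^(2k) in sinh(A/2) / (A/2).  *)
Definition sinhc_coef (K : fieldType) (k : nat) : K :=
  ((4 ^ k * (k.*2.+1)`!)%N%:R)^-1.

Definition sinhc : mseries 1 rat :=
  mser_sum 0 (fun k => sinhc_coef rat k *: mser_poly 'X_ord0 ^+ k.*2).

Definition c2 (n : nat) : rat :=
  4%:R^-1 * scoef (mser_log sinhc) [multinom n.*2 | _ < 1].

(* sinh(A/2) / (A/2), for A without constant term.  *)
Definition sinhc_mx {n m} {K : fieldType} (A : 'M[mseries n K]_m) :
    'M[mseries n K]_m :=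
  \matrix_(i, j) mser_sum 0 (fun k => sinhc_coef K k *: (A ^+ k.*2) i j).

Record is_lie_bracket (K : fieldType) (g : lmodType K) (br : g -> g -> g) :
    Prop := IsLieBracket {
  lie_linearr : forall x, linear (br x);
  lie_linearl : forall y, linear (br^~ y);
  lie_alt : forall x, br x x = 0;
  lie_jacobi : forall x y z, br x (br y z) + br y (br z x) + br z (br x y) = 0
}.

Definition is_lie_to_alg (K : fieldType) (g : lmodType K) (br : g -> g -> g)
    (A : algType K) (f : g -> A) : Prop :=
  forall x y, f (br x y) = f x * f y - f y * f x.

(* (U, j) is the universal enveloping algebra of (g, br).  *)
Record is_enveloping (K : fieldType) (g : lmodType K) (br : g -> g -> g)
    (U : algType K) (j : {linear g -> U}) : Prop := IsEnveloping {
  env_lie : is_lie_to_alg br j;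
  env_univ : forall (A : algType K) (f : {linear g -> A}),
    is_lie_to_alg br f ->
    exists2 h : {lrmorphism U -> A}, h \o j =1 f &
      forall h' : {lrmorphism U -> A}, h' \o j =1 f -> h' =1 h
}.

(* The monomial X^M as the word in which each i occurs M i times.  *)
Fact mword_subproof n (M : 'X_{1..n}) :
  size (flatten [seq nseq (M i) i | i <- enum 'I_n]) == mdeg M.
Proof.
rewrite size_flatten sumnE big_map big_map big_enum mdegE /=.
by apply/eqP/eq_bigr => i _; rewrite size_nseq.
Qed.
Definition mword n (M : 'X_{1..n}) : (mdeg M).-tuple 'I_n :=
  Tuple (mword_subproof M).

Section Duflo.
Context {K : fieldType} {g : vectType K} (br : g -> g -> g).
Context {m : nat} (b : m.-tuple g).

(* Throughout, {mpoly K[m]} stands both for S(g), with 'X_i = b_i, and for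
   S(g^* ), with 'X_i = b_i^*; mseries m K is the completion of the latter.  *)

Definition struct_const (i j k : 'I_m) : K :=
  coord b k (br (tnth b i) (tnth b j)).

(* The derivation of S(g) extending y |-> [x, y].  *)
Definition ad_act (x : g) (P : {mpoly K[m]}) : {mpoly K[m]} :=
  \sum_(i < m) (\sum_(k < m) coord b k (br x (tnth b i)) *: 'X_k) * P^`M(i).

(* The derivation of S(g^* ) extending the coadjoint action, for which
   (x . b_i^* )(b_k) = - b_i^*([x, b_k]).  *)
Definition coad_act (x : g) (f : {mpoly K[m]}) : {mpoly K[m]} :=
  \sum_(i < m) (\sum_(k < m) (- coord b i (br x (tnth b k))) *: 'X_k) * f^`M(i).

Definition S_invariant (P : {mpoly K[m]}) : Prop := forall x, ad_act x P = 0.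

(* W n is W_{2n}; the index e_{t+1} of the text is e t here, and ordS is
   the cyclic successor.  *)
Definition W (n : nat) : {mpoly K[m]} :=
  \sum_(k : {ffun 'I_n.*2 -> 'I_m}) \sum_(e : {ffun 'I_n.*2 -> 'I_m})
    (\prod_(t < n.*2) struct_const (k t) (e t) (k (ordS t)))
      *: \prod_(t < n.*2) 'X_(e t).

Definition Omega : mseries m K :=
  mser_exp (mser_sum 1 (fun n => (2%:R * ratr (c2 n)) *: mser_poly (W n))).

(* The matrix of ad_x in the basis b, as a matrix of linear functions of x,
   that is, of elements of g^*; see ad_mx_eval.  *)
Definition ad_mx : 'M[{mpoly K[m]}]_m :=
  \matrix_(i, j) \sum_(e < m) struct_const e j i *: 'X_e.

Lemma ad_mx_eval (x : g) i j :
  is_lie_bracket br -> basis_of fullv b ->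
  (ad_mx i j).@[fun e => coord b e x] = coord b i (br x (tnth b j)).
Proof.
move=> brL bB; rewrite mxE raddf_sum /=.
pose F := fun y => coord b i (br y (tnth b j)).
have linF : scalar F by move=> c y z; rewrite /F lie_linearl ?linearP.
pose F' : {scalar g} := HB.pack F (GRing.isLinear.Build K g K _ F linF).
rewrite -/(F x) -[F]/(F' : g -> K) {2}(coord_basis bB (memvf x)) linear_sum.
apply: eq_bigr => e _; rewrite mevalZ mevalXU mulrC.
by rewrite linearZ /= /F /struct_const (tnth_nth 0).
Qed.

(* <b^*_alpha, b_beta> for monomials b^*_alpha and b_beta.  *)
Definition mono_pairing (al be : 'X_{1..m}) : K :=
  if mdeg al == mdeg be then
    \sum_(s : 'S_(mdeg al)) \prod_(i < mdeg al)
      (onth (mword al) i == onth (mword be) (s i))%:R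
  else 0.

Definition pairing (f P : {mpoly K[m]}) : K :=
  \sum_(al <- msupp f) \sum_(be <- msupp P)
    f@_al * P@_be * mono_pairing al be.

Definition diff_op (f : mseries m K) (P : {mpoly K[m]}) : {mpoly K[m]} :=
  \sum_(al : 'X_{1..m < msize P}) scoef f al *: P^`M[al].

Context {U : algType K} (j : {linear g -> U}).

(* mseries m U stands for the completion of S(g^* ) (x) U(g).  *)

Definition iota_elt : mseries m U :=
  mser_poly (\sum_(i < m) j (tnth b i) *: 'X_i).

Definition exp_iota : mseries m U :=
  mser_sum 0 (fun d => (d`!%:R^-1)%:A *: iota_elt ^+ d).

Definition mser_tensor1 (f : mseries m K) : mseries m U :=
  MSeries (fun M => (scoef f M)%:A).

(* By right exactness of - (x) U(g), the completion of S(g^* )_g (x) U(g) is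
   the quotient of that of S(g^* ) (x) U(g) by the elements whose component
   in each degree d is a finite sum of terms (x . f) (x) u; f need not be
   homogeneous, since the coadjoint action preserves the degree.  *)
Definition coinv_null_prop (F : mseries m U) : Prop :=
  forall d, exists s : seq (g * {mpoly K[m]} * U),
    forall M, mdeg M = d ->
      scoef F M = \sum_(t <- s) (coad_act t.1.1 t.1.2)@_M *: t.2.

Definition coinv_null (F : mseries m U) : bool := `[< coinv_null_prop F >].

Fact coinv_null_zmod_closed : zmod_closed coinv_null.
Proof.
split=> [|F G /asboolP hF /asboolP hG].
  apply/asboolP => d; exists [::] => M _.
  by rewrite big_nil /= mcoeff0.
apply/asboolP => d; have [s hs] := hF d; have [t ht] := hG d.
exists (s ++ [seq (p.1, - p.2) | p <- t]) => M dM.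
rewrite big_cat big_map /= hs // ht //; congr (_ + _).
by rewrite -sumrN; apply: eq_bigr => p _; rewrite scalerN.
Qed.

HB.instance Definition _ :=
  GRing.isZmodClosed.Build (mseries m U) coinv_null coinv_null_zmod_closed.

Definition coinv_tensor :=
  {ideal_quot (GRing.ZmodClosed.clone (mseries m U) coinv_null _)}.

Definition Upsilon : coinv_tensor :=
  \pi_coinv_tensor (exp_iota * mser_tensor1 Omega).

(* <f (x) u, P> = <f, P> u; only degrees up to that of P contribute.  *)
Definition tensor_pairing (F : mseries m U) (P : {mpoly K[m]}) : U :=
  \sum_(al : 'X_{1..m < msize P}) pairing 'X_[al] P *: scoef F al.

(* The induced pairing on coinvariants: for invariant P the value does not
   depend on the representative, see coinv_pairing_pi.  *)
Definition coinv_pairing (Y : coinv_tensor) (P : {mpoly K[m]}) : U :=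
  tensor_pairing (repr Y) P.

Definition duflo (P : {mpoly K[m]}) : U := coinv_pairing Upsilon P.

Definition symmetrization (P : {mpoly K[m]}) : U :=
  \sum_(be <- msupp P) P@_be *:
    ((mdeg be)`!%:R^-1 *:
      \sum_(s : 'S_(mdeg be)) \prod_(i < mdeg be)
        j (tnth b (tnth (mword be) (s i)))).

(* The adjoint action of x on U(g) is the commutator with j x.  *)
Definition U_invariant (u : U) : Prop := forall x, j x * u - u * j x = 0.

End Duflo.

Section Perm.
Context {K : comNzRingType} {I : finType}.

Let per d (s t : 'I_d -> I) : K :=
  \sum_(p : 'S_d) \prod_i (s i == t (p i))%:R.

Let cnt d (s : 'I_d -> I) (a : I) : nat := (\sum_i (s i == a))%N.

Let per_lift d (s t : 'I_d.+1 -> I) :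
  per s t = \sum_j (s ord0 == t j)%:R *
                per (s \o lift ord0) (t \o lift j).
Proof.
rewrite /per (partition_big (fun p : 'S_d.+1 => p ord0) xpredT) //=.
apply: eq_bigr => j _.
rewrite (reindex (lift_perm ord0 j)); last first.
  pose ulsf i (s : 'S_d.+1) k := odflt k (unlift (s i) (s (lift i k))).
  have ulsfK i (s' : 'S_d.+1) k: lift (s' i) (ulsf i s' k) = s' (lift i k).
    rewrite /ulsf; have:= neq_lift i k.
    by rewrite -(can_eq (permK s')) => /unlift_some[] ? ? ->.
  have inj_ulsf: injective (ulsf ord0 _).
    move=> s'; apply: can_inj (ulsf (s' ord0) s'^-1%g) _ => k'.
    by rewrite {1}/ulsf ulsfK !permK liftK.
  exists (fun s => perm (inj_ulsf s)) => [s' _ | s'].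
    by apply/permP=> k'; rewrite permE /ulsf lift_perm_lift lift_perm_id liftK.
  move/(s' _ =P _) => si0; apply/permP=> k.
  case: (unliftP ord0 k) => [k'|] ->; rewrite ?lift_perm_id //.
  by rewrite lift_perm_lift permE -si0 ulsfK.
rewrite big_distrr /=; apply: eq_big => p; first by rewrite lift_perm_id eqxx.
move=> _; rewrite big_ord_recl lift_perm_id; congr (_ * _).
by apply: eq_bigr => i _; rewrite lift_perm_lift.
Qed.

Let cnt_lift d (t : 'I_d.+1 -> I) j a :
  cnt t a = ((t j == a) + cnt (t \o lift j) a)%N.
Proof. by rewrite /cnt (bigD1_ord j). Qed.

Let perE d (s t : 'I_d -> I) :
  per s t = ([forall a, cnt s a == cnt t a] * \prod_a (cnt s a)`!)%N%:R.
Proof.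
elim: d s t => [|d IHd] s t.
  rewrite /per (big_pred1 (perm_one 'I_0)) => [|p]; last first.
    by symmetry; apply/eqP/permP; case.
  rewrite big_ord0; have cnt0 (u : 'I_0 -> I) a : cnt u a = 0%N by rewrite /cnt big_ord0.
  rewrite big1 => [|a _]; last by rewrite cnt0.
  by case: forallP => // -[] a; rewrite !cnt0.
rewrite per_lift.
transitivity (\sum_(j | t j == s ord0)
   ([forall a, cnt s a == cnt t a] * \prod_a (cnt (s \o lift ord0) a)`!)%N%:R : K).
  rewrite [RHS]big_mkcond; apply: eq_bigr => j _; rewrite eq_sym.
  case: eqP => [tj|_]; last by rewrite mul0r.
  rewrite mul1r IHd; congr ((nat_of_bool _ * _)%:R).
  apply: eq_forallb => a.
  by rewrite (cnt_lift s ord0) (cnt_lift t j) tj eqn_add2l.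
rewrite sumr_const -mulrnA; congr (_%:R).
have -> : #|[pred j | t j == s ord0]| = cnt t (s ord0).
  by rewrite /cnt -sum1_card big_mkcond; apply: eq_bigr => i _ /=;
     rewrite inE; case: eqP.
case: forallP => [eq_cnt|]; last by rewrite !mul0n.
rewrite -(eqP (eq_cnt _)) !mul1n (bigD1 (s ord0)) //= [RHS](bigD1 (s ord0)) //=.
rewrite mulnAC; congr (_ * _)%N.
  by rewrite (cnt_lift s ord0 (s ord0)) eqxx add1n factS mulnC.
apply: eq_bigr => a; rewrite (cnt_lift s ord0 a) eq_sym.
by case: eqP.
Qed.

Lemma sum_perm_onth d e (s : d.-tuple I) (t : e.-tuple I) : d = e ->
  \sum_(p : 'S_d) \prod_(i < d) (onth s i == onth t (p i))%:R =
  ([forall a, count_mem a s == count_mem a t] * \prod_a (count_mem a s)`!)%N%:R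
  :> K.
Proof.
move=> de; case: e / de t => t.
have cntE (u : d.-tuple I) a : cnt (tnth u) a = count_mem a u.
  by rewrite -sum1_count big_tuple big_mkcond; apply: eq_bigr => i _ /=; case: eqP.
have onthE (u : d.-tuple I) (i : 'I_d) : onth u i = Some (tnth u i).
  by rewrite onthE (nth_map (tnth u i)) ?size_tuple // -tnth_nth.
transitivity (per (tnth s) (tnth t)).
  by apply: eq_bigr => p _; apply: eq_bigr => i _; rewrite !onthE.
rewrite perE; congr ((nat_of_bool _ * _)%:R).
  by apply: eq_forallb => a; rewrite !cntE.
by apply: eq_bigr => a _; rewrite cntE.
Qed.

End Perm.

Lemma count_mword n (M : 'X_{1..n}) a : count_mem a (mword M) = M a.
Proof.
rewrite [LHS]count_flatten sumnE 2!big_map big_enum (bigD1 a) //=.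
rewrite count_nseq /= eqxx mul1n big1 ?addn0 // => i ne.
by rewrite count_nseq /= (negPf ne).
Qed.

Lemma mono_pairingE {K : fieldType} {m} (al be : 'X_{1..m}) :
  mono_pairing al be = (al == be)%:R * (\prod_a (al a)`!)%:R :> K.
Proof.
rewrite /mono_pairing; case: eqP => [eqd|]; last first.
  by case: eqP => [->|_ _]; rewrite ?mul0r.
rewrite sum_perm_onth // natrM; congr (_%:R * _%:R).
  congr (nat_of_bool _); apply/forallP/eqP => [h|-> //].
  by apply/mnmP => i; rewrite -!count_mword; apply/eqP/h.
by apply: eq_bigr => a _; rewrite count_mword.
Qed.

Section Descent.
Context {K : fieldType} {g : vectType K} (br : g -> g -> g).
Context {m : nat} (b : m.-tuple g).
Implicit Types f P : {mpoly K[m]}.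

Definition mfact (al : 'X_{1..m}) : K := (\prod_a (al a)`!)%:R.

Lemma pairingE f P :
  pairing f P = \sum_(al <- msupp f) f@_al * (P@_al * mfact al).
Proof.
apply: eq_bigr => al _; case: (boolP (al \in msupp P)) => alP.
  rewrite (bigD1_seq al) //= big1 => [|be ne]; last first.
    by rewrite mono_pairingE eq_sym (negPf ne) mul0r mulr0.
  by rewrite addr0 mono_pairingE eqxx (mul1r (mfact al)) mulrA.
rewrite (memN_msupp_eq0 alP) mul0r mulr0 big_seq big1 // => be beP.
rewrite mono_pairingE; case: eqP => [e|]; last by rewrite mul0r mulr0.
by rewrite e beP in alP.
Qed.

Lemma pairing_big d f P : (msize f <= d)%N ->
  pairing f P = \sum_(al : 'X_{1..m < d}) f@_al * (P@_al * mfact al).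
Proof.
move=> led; rewrite pairingE (big_mksub 'X_{1..m < d}) //=; first last.
- by move=> x /msize_mdeg_lt /leq_trans; apply.
- exact: msupp_uniq.
rewrite big_mkcond; apply: eq_bigr => al _.
by case: ifPn => // /memN_msupp_eq0 ->; rewrite mul0r.
Qed.

Lemma pairing_linear_r f : scalar (pairing f).
Proof.
move=> c P Q; rewrite !pairingE mulr_sumr -big_split /=.
by apply: eq_bigr => al _; rewrite mcoeffD mcoeffZ mulrDl mulrDr -mulrA (mulrCA _ c).
Qed.
HB.instance Definition _ f :=
  GRing.isLinear.Build K {mpoly K[m]} K _ (pairing f) (pairing_linear_r f).

Lemma pairingC f P : pairing f P = pairing P f.
Proof.
rewrite (@pairing_big (maxn (msize f) (msize P))) ?leq_maxl //.
rewrite (@pairing_big (maxn (msize f) (msize P))) ?leq_maxr //.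
by apply: eq_bigr => al _; rewrite mulrCA.
Qed.

Lemma pairing_suml (I : Type) (r : seq I) (Q : pred I) F P :
  pairing (\sum_(i <- r | Q i) F i) P = \sum_(i <- r | Q i) pairing (F i) P.
Proof. by rewrite pairingC linear_sum; apply: eq_bigr => i _; exact: pairingC. Qed.

Lemma pairingZl c f P : pairing (c *: f) P = c * pairing f P.
Proof. by rewrite pairingC linearZ /= pairingC. Qed.

Lemma pairing_mono al P : pairing 'X_[al] P = P@_al * mfact al.
Proof. by rewrite pairingE msuppX big_seq1 mcoeffX eqxx mul1r. Qed.

Lemma mfactS al i : mfact (al + U_(i)) = (al i).+1%:R * mfact al.
Proof.
rewrite /mfact (bigD1 i) //= [in RHS](bigD1 i) //= -natrM mulnA.
rewrite mnmDE mnm1E eqxx addn1 factS; congr ((_ * _ * _)%:R)%N.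
by apply: eq_bigr => a ne; rewrite mnmDE mnm1E eq_sym (negPf ne) addn0.
Qed.

Lemma pairingXl i f P : pairing ('X_i * f) P = pairing f P^`M(i).
Proof.
rewrite [f]mpolyE mulr_sumr !pairing_suml /=.
apply: eq_bigr => al _.
rewrite -scalerAr !pairingZl /= -mpolyXD !pairing_mono addmC mfactS.

by rewrite mcoeff_deriv mulr_natl mulrnAl mulrnAr.
Qed.

Lemma pairing_coad x f P :
  pairing (coad_act br b x f) P = - pairing f (ad_act br b x P).
Proof.
rewrite /coad_act /ad_act pairing_suml [in RHS]linear_sum -sumrN /=.
under eq_bigr => i _.
  rewrite mulr_suml pairing_suml /=.
  under eq_bigr => k _.
    rewrite -scalerAl pairingZl /= pairingXl pairingC -pairingXl pairingC.
  over.
over.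
rewrite exchange_big; apply: eq_bigr => k _ /=.
rewrite mulr_suml [in RHS]linear_sum -sumrN; apply: eq_bigr => i _ /=.
by rewrite -scalerAl linearZ /= mulNr.
Qed.

Lemma ad_act_linear x : linear (ad_act br b x).
Proof.
move=> c P Q; rewrite /ad_act scaler_sumr -big_split; apply: eq_bigr => i _ /=.
by rewrite linearP /= mulrDr scalerAr.
Qed.
HB.instance Definition _ x :=
  GRing.isLinear.Build K {mpoly K[m]} {mpoly K[m]} _ (ad_act br b x)
    (ad_act_linear x).

Lemma pihomog_sum d (I : Type) (r : seq I) (F : I -> {mpoly K[m]}) :
  pihomog mdeg d (\sum_(t <- r) F t) = \sum_(t <- r) pihomog mdeg d (F t).
Proof. exact: linear_sum. Qed.

Lemma mulX_deriv_pihomog d k i P :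
  'X_k * (pihomog mdeg d P)^`M(i) = pihomog mdeg d ('X_k * P^`M(i)).
Proof.
have deS (r : seq 'X_{1..m}) (F : 'X_{1..m} -> {mpoly K[m]}) :
    (\sum_(t <- r) F t)^`M(i) = \sum_(t <- r) (F t)^`M(i) by exact: linear_sum.
have piX be : pihomog mdeg d ('X_[be] : {mpoly K[m]}) =
    if mdeg be == d then 'X_[be] else 0 by exact: pihomogX.
rewrite [P]mpolyE pihomog_sum !deS !mulr_sumr pihomog_sum.
apply: eq_bigr => al _; rewrite !linearZ /= -!scalerAr linearZ /=.
congr (_ *: _); rewrite piX mderivX.
case ali: (al i) => [|c].
  rewrite scale0r mulr0 linear0.
  by case: ifP => _; rewrite ?linear0 ?mulr0 // mderivX ali scale0r mulr0.
rewrite -scalerAr -mpolyXD linearZ /= piX.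
have le: (U_(i) <= al)%MM by rewrite lep1mP ali.
have -> : mdeg (U_(k) + (al - U_(i)))%MM = mdeg al.
  by rewrite -{2}(submK le) !mdegD !mdeg1 addnC.
by case: ifP => _; rewrite ?mderivX ?ali -?scalerAr -?mpolyXD // linear0 mulr0 scaler0.
Qed.

Lemma ad_act_pihomog x d P :
  ad_act br b x (pihomog mdeg d P) = pihomog mdeg d (ad_act br b x P).
Proof.
rewrite /ad_act pihomog_sum; apply: eq_bigr => i _.
rewrite !mulr_suml pihomog_sum; apply: eq_bigr => k _ /=.
by rewrite -!scalerAl linearZ /= mulX_deriv_pihomog.
Qed.

Context {U : algType K}.

Lemma tensor_pairing_coinv (F : mseries m U) P :
  S_invariant br b P -> coinv_null br b F -> tensor_pairing F P = 0.
Proof.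
move=> Pinv /asboolP Fnull; rewrite /tensor_pairing.
rewrite (partition_big (fun al : 'X_{1..m < msize P} => Ordinal (bmdeg al))
           xpredT) //=.
rewrite big1 // => d _; have [s Fs] := Fnull d.
transitivity (\sum_(t <- s)
    pairing (coad_act br b t.1.1 t.1.2) (pihomog mdeg d P) *: t.2).
  transitivity (\sum_(al : 'X_{1..m < msize P} | mdeg al == d) \sum_(t <- s)
     (P@_al * pairing 'X_[al] (coad_act br b t.1.1 t.1.2)) *: t.2).
    apply: eq_big => // al /eqP ald; rewrite Fs -?ald // scaler_sumr.
    apply: eq_bigr => t _; rewrite scalerA !pairing_mono; congr (_ *: _).
    by rewrite -mulrA [_ * mfact _]mulrC mulrA.
  rewrite exchange_big; apply: eq_bigr => t _ /=.
  rewrite -scaler_suml pairingC (@pihomogwE _ _ _ _ (msize P)) //; congr (_ *: _).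
  rewrite pairing_suml /=; apply: eq_bigr => al _.
  by rewrite pairingZl.
rewrite big1_seq // => t _.
by rewrite pairing_coad ad_act_pihomog Pinv linear0 linear0 oppr0 scale0r.
Qed.

Lemma tensor_pairingB (F G : mseries m U) P :
  tensor_pairing (F - G) P = tensor_pairing F P - tensor_pairing G P.
Proof.
by rewrite /tensor_pairing -sumrB; apply: eq_bigr => al _; rewrite -scalerBr.
Qed.

Lemma coinv_pairing_pi (F : mseries m U) P : S_invariant br b P ->
  coinv_pairing (\pi_(coinv_tensor br b (U := U)) F) P = tensor_pairing F P.
Proof.
move=> Pinv; apply/eqP; rewrite -subr_eq0 -tensor_pairingB; apply/eqP.
apply: tensor_pairing_coinv => //.
suff: repr (\pi_(coinv_tensor br b (U := U)) F) = F %[mod coinv_tensor br b (U := U)].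
  by move/eqP; rewrite -Quotient.idealrBE.
by rewrite reprK.
Qed.
End Descent.

(* Main.v *)
Require Import Defs.
From mathcomp Require Import all_boot all_order all_algebra perm.
From mathcomp Require Import mpoly.
From HB Require Import structures.
From mathcomp Require Import ssrcomplements.

Import GRing.Theory.
Local Open Scope ring_scope.

Set Implicit Arguments.
Unset Strict Implicit.

(** Two facts carry the theorem: Omega solves a first-order differential
    equation, and exp(iota) is invariant under the diagonal action.

    - Trace formula ([Omega_trace]).  W_{2n} is a sum over closed paths
      k_0, ..., k_{2n-1} of products of entries of the matrix of ad_x, up to
      transposition and the sign c_{ij}^k = - c_{ji}^k; an even number of signs
      cancels ([W_trace]).

    - Determinant formula ([exp_c2_trace_sqrt_det]).  Write s for
      sinh(x/2)/(x/2), A for the matrix of ad_x, and E for the Euler operator,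
      which multiplies the component of degree k by k.  As A is linear in x,
      E A = A, hence E(s(A)) = s(A) T with T = A s'(A)/s(A), and Jacobi's
      formula gives E(det s(A)) = tr(T) det s(A).  The coefficients of
      x s'(x)/s(x) are 2n . 4 c_{2n} ([sinhc_log_coef]), so Omega^2 satisfies
      the same equation.  In characteristic zero a solution is determined by its
      constant term ([euler_ode_unique]).

    - Duflo map ([tensor_pairing_exp_iota]).  The coefficient of e^iota at a
      monomial al, times al!, is the symmetrization of b^al
      ([exp_iota_coef]): expanding iota^d gives all words with content al, and
      each is a rearrangement of the sorted word in al! ways.  Pairing with
      Omega e^iota instead of e^iota amounts to applying Omega(d/db) to P
      first, because multiplication by b_i^* is adjoint to d/db_i.

    - Invariance of D(P) ([duflo_invariant]).  By Jacobi the coadjoint action of x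
      differentiates the matrix of ad to a commutator, so it kills the traces
      and Omega; and it differentiates exp(iota) to its commutator with x in U.
      Thus [x, D(P)] is, up to sign, the pairing of P with an element of the
      image of the coadjoint action, which vanishes for invariant P. *)

(** * Power series and their order filtration *)

Section SeriesOrder.
Context {n : nat} {R : nzRingType}.
Implicit Types (f g h : mseries n R) (M : 'X_{1..n}) (F G : nat -> mseries n R).

Lemma scoefD f g M : scoef (f + g) M = scoef f M + scoef g M.
Proof. by []. Qed.
Lemma scoefN f M : scoef (- f) M = - scoef f M.
Proof. by []. Qed.
Lemma scoef0 M : scoef (0 : mseries n R) M = 0.
Proof. exact: mcoeff0. Qed.
Lemma scoef1 M : scoef (1 : mseries n R) M = (M == 0%MM)%:R.
Proof. by rewrite -[LHS]/((1 : {mpoly R[n]})@_M) mcoeff1. Qed.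
Lemma scoefZ c f M : scoef (c *: f) M = c * scoef f M.
Proof. by []. Qed.
Lemma scoef_sum I (r : seq I) (P : pred I) (F : I -> mseries n R) M :
  scoef (\sum_(i <- r | P i) F i) M = \sum_(i <- r | P i) scoef (F i) M.
Proof. exact: (big_morph (fun f => scoef f M) (fun f g => scoefD f g M) (scoef0 M)). Qed.
Lemma scoefMn f k M : scoef (f *+ k) M = scoef f M *+ k.
Proof. by elim: k => [|k IH]; rewrite ?mulr0n ?scoef0 // !mulrS scoefD IH. Qed.
Lemma scoefM f g M : scoef (f * g) M =
  \sum_(k : 'X_{1..n < (mdeg M).+1, (mdeg M).+1} | M == (k.1 + k.2)%MM)
       scoef f k.1 * scoef g k.2.
Proof. by []. Qed.

Lemma scoefM0 f g : scoef (f * g) 0%MM = scoef f 0%MM * scoef g 0%MM.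
Proof.
rewrite scoefM (big_pred1 (bm0, bm0)) // => -[[k1 h1] [k2 h2]].
rewrite -[RHS]/((k1 == 0%MM) && (k2 == 0%MM)) -[LHS]/(0%MM == (k1 + k2)%MM).
by rewrite eq_sym -!mdeg_eq0 mdegD addn_eq0.
Qed.

Lemma mser_poly_is_zmod_morphism : zmod_morphism (@mser_poly n R).
Proof. by move=> p q; apply: mseriesP => M /=; rewrite mcoeffB. Qed.
Lemma mser_poly_is_monoid_morphism : monoid_morphism (@mser_poly n R).
Proof. by split=> // p q; apply: mseriesP => M /=; rewrite mcoeffM. Qed.
HB.instance Definition _ := GRing.isZmodMorphism.Build {mpoly R[n]} (mseries n R)
  (@mser_poly n R) mser_poly_is_zmod_morphism.
HB.instance Definition _ := GRing.isMonoidMorphism.Build {mpoly R[n]} (mseries n R)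
  (@mser_poly n R) mser_poly_is_monoid_morphism.

Lemma mser_polyZ c p : mser_poly (c *: p) = c *: mser_poly p :> mseries n R.
Proof. by apply: mseriesP => M; rewrite scoefZ /= mcoeffZ. Qed.

Definition const_coef f : R := scoef f 0%MM.
Lemma const_coef_is_zmod_morphism : zmod_morphism const_coef.
Proof. by []. Qed.
Lemma const_coef_is_monoid_morphism : monoid_morphism const_coef.
Proof. by split=> [|f g]; rewrite /const_coef ?scoef1 ?eqxx // scoefM0. Qed.
HB.instance Definition _ := GRing.isZmodMorphism.Build (mseries n R) R
  const_coef const_coef_is_zmod_morphism.
HB.instance Definition _ := GRing.isMonoidMorphism.Build (mseries n R) R
  const_coef const_coef_is_monoid_morphism.

Lemma mser_scaleAl c f g : c *: (f * g) = (c *: f) * g.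
Proof.
apply: mseriesP => M; rewrite scoefZ !scoefM mulr_sumr.
by apply: eq_bigr => k _; rewrite mulrA.
Qed.

(** f lies in the d-th power of the ideal of series without constant term. *)
Definition ord_ge d f := forall M, (mdeg M < d)%N -> scoef f M = 0.

Lemma ord_ge_le d e f : (d <= e)%N -> ord_ge e f -> ord_ge d f.
Proof. by move=> le hf M hM; apply/hf/(leq_trans hM). Qed.
Lemma ord_ge_at0 f : ord_ge 0 f. Proof. by []. Qed.
Lemma ord_ge0 d : ord_ge d 0. Proof. by move=> M _; rewrite scoef0. Qed.
Lemma ord_geD d f g : ord_ge d f -> ord_ge d g -> ord_ge d (f + g).
Proof. by move=> hf hg M hM; rewrite scoefD hf // hg // addr0. Qed.
Lemma ord_geN d f : ord_ge d f -> ord_ge d (- f).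
Proof. by move=> hf M hM; rewrite scoefN hf // oppr0. Qed.
Lemma ord_geZ c d f : ord_ge d f -> ord_ge d (c *: f).
Proof. by move=> hf M hM; rewrite scoefZ hf // mulr0. Qed.
Lemma ord_ge_sum d I (r : seq I) (P : pred I) (F : I -> mseries n R) :
  (forall i, P i -> ord_ge d (F i)) -> ord_ge d (\sum_(i <- r | P i) F i).
Proof. by move=> hF; elim/big_ind: _ => //; [apply: ord_ge0|apply: ord_geD]. Qed.
Lemma ord_geM d e f g : ord_ge d f -> ord_ge e g -> ord_ge (d + e) (f * g).
Proof.
move=> hf hg M hM; rewrite scoefM big1 // => -[k1 k2] /= /eqP eM.
case: (ltnP (mdeg k1) d) => h1; first by rewrite hf // mul0r.
case: (ltnP (mdeg k2) e) => h2; first by rewrite hg // mulr0.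
by have := leq_add h1 h2; rewrite -mdegD -eM leqNgt hM.
Qed.
Lemma ord_geMl d f g : ord_ge d g -> ord_ge d (f * g).
Proof. by move=> hg; apply: (ord_geM (@ord_ge_at0 f) hg). Qed.
Lemma ord_geMr d f g : ord_ge d f -> ord_ge d (f * g).
Proof. by move=> hf; rewrite -[d]addn0; apply: (ord_geM hf (@ord_ge_at0 g)). Qed.
Lemma ord_geX d f k : ord_ge d f -> ord_ge (d * k) (f ^+ k).
Proof.
move=> hf; elim: k => [|k IH]; first by rewrite muln0.
by rewrite exprS mulnS; apply: ord_geM.
Qed.
Lemma ord_geX1 f k : ord_ge 1 f -> ord_ge k (f ^+ k).
Proof. by move=> hf; rewrite -[k in ord_ge k]mul1n; apply: ord_geX. Qed.
Lemma ord_ge1P f : ord_ge 1 f <-> scoef f 0%MM = 0.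
Proof.
split=> [hf|h0 M]; first by apply: hf; rewrite mdeg0.
by rewrite ltnS leqn0 mdeg_eq0 => /eqP ->.
Qed.

(** The order filtration is separated, so equalities of series can be checked
    modulo every power of the maximal ideal. *)
Lemma ord_ge_eq f g : (forall d, ord_ge d (f - g)) -> f = g.
Proof.
move=> h; apply: mseriesP => M; apply/eqP; rewrite -subr_eq0 -scoefN -scoefD.
by rewrite (h (mdeg M).+1).
Qed.

Lemma ord_ge_trans d f g h : ord_ge d (f - g) -> ord_ge d (g - h) -> ord_ge d (f - h).
Proof. by move=> hf hg; have:= ord_geD hf hg; rewrite addrA subrK. Qed.
Lemma ord_geBC d f g : ord_ge d (f - g) -> ord_ge d (g - f).
Proof. by move/ord_geN; rewrite opprB. Qed.
Lemma ord_geMB d f f' g g' :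
  ord_ge d (f - f') -> ord_ge d (g - g') -> ord_ge d (f * g - f' * g').
Proof.
move=> hf hg; apply: (@ord_ge_trans _ _ (f' * g)).
  by rewrite -mulrBl; apply: ord_geMr.
by rewrite -mulrBr; apply: ord_geMl.
Qed.

(** The condition under which [mser_sum] is an honest infinite sum: the
    truncation in its definition then drops vanishing terms only. *)
Definition summable (a : nat) (F : nat -> mseries n R) :=
  forall k, (a <= k)%N -> ord_ge k (F k).

Lemma mser_sum_trunc a F d : summable a F ->
  ord_ge d (mser_sum a F - \sum_(a <= k < d) F k).
Proof.
move=> hF M hM; rewrite scoefD scoefN scoef_sum /=; apply/eqP; rewrite subr_eq0.
apply/eqP; rewrite (big_nat_widen _ _ d) //= [RHS]big_mkcond /= [LHS]big_mkcond /=.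
rewrite big_seq [RHS]big_seq; apply: eq_bigr => k; rewrite mem_index_iota => /andP[ak kd].
by case: ltnP => // lt; rewrite hF.
Qed.

Lemma ord_ge_mser_sum a F d : (forall k, (a <= k)%N -> ord_ge d (F k)) ->
  ord_ge d (mser_sum a F).
Proof.
move=> hF M hM /=; rewrite big_seq big1 // => k.
by rewrite mem_index_iota => /andP[ak _]; apply: hF.
Qed.

Lemma eq_mser_sum a F G : (forall k, (a <= k)%N -> F k = G k) ->
  mser_sum a F = mser_sum a G.
Proof.
move=> e; apply: mseriesP => M /=; apply: eq_big_nat => k /andP[ak _].
by rewrite e.
Qed.

Lemma mser_sum_recl a F : summable a F ->
  mser_sum a F = F a + mser_sum a.+1 F.
Proof.
move=> hF; apply: mseriesP => M; rewrite scoefD /=.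
case: (ltnP a (mdeg M).+1) => h; first by rewrite big_ltn.
by rewrite !big_geq ?(leqW h) // addr0 hF.
Qed.

Lemma mser_sumMl a F g : summable a F ->
  g * mser_sum a F = mser_sum a (fun k => g * F k).
Proof.
move=> hF; apply: ord_ge_eq => d.
have hgF : summable a (fun k => g * F k) by move=> k ak; apply/ord_geMl/hF.
apply: (ord_ge_trans _ (ord_geBC (mser_sum_trunc (d := d) hgF))).
by rewrite -mulr_sumr -mulrBr; apply/ord_geMl/mser_sum_trunc.
Qed.

Lemma mser_sumMr a F g : summable a F ->
  mser_sum a F * g = mser_sum a (fun k => F k * g).
Proof.
move=> hF; apply: ord_ge_eq => d.
have hgF : summable a (fun k => F k * g) by move=> k ak; apply/ord_geMr/hF.
apply: (ord_ge_trans _ (ord_geBC (mser_sum_trunc (d := d) hgF))).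
by rewrite -mulr_suml -mulrBl; apply/ord_geMr/mser_sum_trunc.
Qed.

Lemma mser_sumMn a F k : mser_sum a F *+ k = mser_sum a (fun i => F i *+ k).
Proof.
apply: mseriesP => M; rewrite scoefMn /= -sumrMnl.
by apply: eq_bigr => i _; rewrite scoefMn.
Qed.

Lemma mser_sumB a F G :
  mser_sum a (fun k => F k - G k) = mser_sum a F - mser_sum a G.
Proof.
by apply: mseriesP => M; rewrite scoefD scoefN /= -sumrB; apply: eq_bigr.
Qed.

End SeriesOrder.

(** * Derivations of power series *)

Section Derivations.
Context {n : nat} {R : nzRingType}.
Implicit Types (f g : mseries n R) (F : nat -> mseries n R).

(** Preserving the order filtration makes D continuous, so that it can be applied
    termwise to infinite sums. *)
Record graded_derivation (D : mseries n R -> mseries n R) : Prop := {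
  der_linear : linear D;
  der_leibniz : forall f g, D (f * g) = D f * g + f * D g;
  der_ord : forall d f, ord_ge d f -> ord_ge d (D f)
}.

Section Theory.
Context (D : mseries n R -> mseries n R) (hD : graded_derivation D).

Lemma derD f g : D (f + g) = D f + D g.
Proof. by have:= der_linear hD 1 f g; rewrite !scale1r. Qed.
Lemma der0 : D 0 = 0.
Proof. by have:= der_linear hD (-1) 0 0; rewrite !scaleN1r oppr0 addr0 addNr. Qed.
Lemma derZ c f : D (c *: f) = c *: D f.
Proof. by have:= der_linear hD c f 0; rewrite der0 !addr0. Qed.
Lemma derB f g : D (f - g) = D f - D g.
Proof. by rewrite -[- g]scaleN1r derD derZ scaleN1r. Qed.
Lemma derN f : D (- f) = - D f.
Proof. by rewrite -scaleN1r derZ scaleN1r. Qed.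
Lemma der_sum I (r : seq I) (P : pred I) (F : I -> mseries n R) :
  D (\sum_(i <- r | P i) F i) = \sum_(i <- r | P i) D (F i).
Proof. exact: (big_morph D derD der0). Qed.
Lemma der1 : D 1 = 0.
Proof.
have:= der_leibniz hD 1 1; rewrite !mulr1 mul1r => e.
by apply: (addrI (D 1)); rewrite addr0 -e.
Qed.

Lemma der_mser_sum a F : summable a F ->
  D (mser_sum a F) = mser_sum a (fun k => D (F k)).
Proof.
move=> hF; apply: ord_ge_eq => d.
have hDF : summable a (fun k => D (F k)) by move=> k ak; apply/(der_ord hD)/hF.
apply: (ord_ge_trans _ (ord_geBC (mser_sum_trunc (d := d) hDF))).
by rewrite -der_sum -derB; apply/(der_ord hD)/mser_sum_trunc.
Qed.

Lemma der_exp_comm f k : GRing.comm f (D f) -> D (f ^+ k) = (D f * f ^+ k.-1) *+ k.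
Proof.
move=> cf; elim: k => [|[|k] IH]; first by rewrite expr0 der1 mulr0n.
  by rewrite expr1 expr0 mulr1.
rewrite exprS der_leibniz // IH -mulrnAr mulrA cf mulrnAr.
by rewrite -mulrA -exprS -mulrS.
Qed.

End Theory.

(** The Euler operator: the sum of the X_i d/dX_i. *)
Definition euler f : mseries n R := MSeries (fun M => scoef f M *+ mdeg M).

Lemma scoef_euler f M : scoef (euler f) M = scoef f M *+ mdeg M.
Proof. by []. Qed.

Lemma euler_derivation : graded_derivation euler.
Proof.
split=> [c f g|f g|d f hf M hM].
- by apply: mseriesP => M; rewrite !(scoefD, scoefZ) /= mulrnDl mulrnAr.
- apply: mseriesP => M; rewrite scoefD /= -sumrMnl -big_split /=.
  apply: eq_bigr => -[k1 k2] /= /eqP eM.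
  have dM : mdeg M = (mdeg k1 + mdeg k2)%N by rewrite -mdegD -eM.
  by rewrite [X in _ *+ X = _]dM mulrnDr mulrnAl mulrnAr.
- by rewrite /= hf // mul0rn.
Qed.

Definition pderiv (i : 'I_n) f : mseries n R :=
  MSeries (fun M => scoef f (M + U_(i))%MM *+ (M i).+1).

Lemma pderiv_linear i : linear (pderiv i).
Proof.
by move=> c f g; apply: mseriesP => M; rewrite !(scoefD, scoefZ) /= mulrnDl mulrnAr.
Qed.
HB.instance Definition _ i := GRing.isLinear.Build R (mseries n R) (mseries n R)
  *:%R (pderiv i) (@pderiv_linear i).

Lemma pderiv_ord i d f : ord_ge d.+1 f -> ord_ge d (pderiv i f).
Proof. by move=> hf M hM; rewrite /= hf ?mul0rn // mdegD mdeg1 addn1. Qed.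

Lemma pderiv_poly i p : pderiv i (mser_poly p) = mser_poly p^`M(i).
Proof. by apply: mseriesP => M /=; rewrite mcoeff_deriv. Qed.

Definition mser_trunc d f : {mpoly R[n]} :=
  \sum_(k : 'X_{1..n < d}) scoef f k *: 'X_[k].

Lemma mser_truncP d f : ord_ge d (f - mser_poly (mser_trunc d f)).
Proof.
move=> M ltMd; rewrite scoefD scoefN /= /mser_trunc linear_sum /=.
rewrite (bigD1 (BMultinom ltMd)) //= mcoeffZ mcoeffX eqxx mulr1 big1 ?addr0 ?subrr //.
move=> k neq_k; rewrite mcoeffZ mcoeffX; case: eqP => [eqkM|_]; last by rewrite mulr0.
by case/eqP: neq_k; apply: val_inj.
Qed.

(** Both sides depend on a coefficient of bounded degree only, so the Leibniz
    rule is inherited from polynomials by truncation. *)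
Lemma pderivM i f g : pderiv i (f * g) = pderiv i f * g + f * pderiv i g.
Proof.
apply: ord_ge_eq => d.
have hf := @mser_truncP d.+1 f; have hg := @mser_truncP d.+1 g.
set p := mser_trunc _ f in hf; set q := mser_trunc _ g in hg.
have dB u v : ord_ge d.+1 (u - v) -> ord_ge d (pderiv i u - pderiv i v).
  by move/(@pderiv_ord i _ _); rewrite linearB.
have lt u v : ord_ge d.+1 (u - v) -> ord_ge d (u - v) by apply: ord_ge_le.
apply: (ord_ge_trans (dB _ _ (ord_geMB hf hg))).
rewrite -rmorphM pderiv_poly mderivM rmorphD !rmorphM /= -!pderiv_poly.
rewrite opprD addrACA; apply: ord_geD; apply: ord_geMB; apply: ord_geBC; auto.
Qed.

Context (l : 'I_n -> mseries n R).

Definition linear_der f := \sum_i l i * pderiv i f.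

(** The coefficients have to commute with all series for the Leibniz rule to
    hold over a noncommutative R, and to have no constant term to compensate
    for the degree that a partial derivative loses. *)
Lemma linear_der_derivation :
  (forall i, ord_ge 1 (l i)) -> (forall i f, GRing.comm (l i) f) ->
  graded_derivation linear_der.
Proof.
move=> l1 lC; split=> [c f g|f g|[//|d] f hf].
- rewrite /linear_der scaler_sumr -big_split; apply: eq_bigr => i _ /=.
  rewrite linearP mulrDr; congr (_ + _).
  by rewrite lC -mser_scaleAl lC.
- rewrite /linear_der mulr_suml mulr_sumr -big_split; apply: eq_bigr => i _ /=.
  by rewrite pderivM mulrDr !mulrA (lC i f).
- apply: ord_ge_sum => i _; rewrite -add1n; apply: ord_geM => //.
  exact: pderiv_ord.
Qed.

End Derivations.

Section ExpLog.
Context {n : nat} {K : fieldType} (charK0 : [pchar K] =i pred0).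
Implicit Types (f g : mseries n K).

Lemma mser_scaleAr c f g : c *: (f * g) = f * (c *: g).
Proof. by rewrite mulrC mser_scaleAl mulrC. Qed.

Lemma natrS_neq0 k : (k.+1%:R : K) != 0.
Proof. by have /pcharf0P -> := charK0. Qed.

Context (D : mseries n K -> mseries n K) (hD : graded_derivation D).

Lemma derX f k : D (f ^+ k) = (D f * f ^+ k.-1) *+ k.
Proof. by apply: der_exp_comm => //; apply: mulrC. Qed.

Lemma summable_exp f (a : nat -> K) b : ord_ge 1 f -> summable b (fun k => a k *: f ^+ k).
Proof. by move=> hf k _; apply/ord_geZ/ord_geX1. Qed.

(** Differentiating f^k / k! gives (f^(k-1) / (k-1)!) f', so the truncated sums
    of the two sides are off by one in length and agree up to order d. *)
Lemma der_mser_exp f : ord_ge 1 f -> D (mser_exp f) = D f * mser_exp f.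
Proof.
move=> hf; have hs a := @summable_exp f a 0 hf.
rewrite /mser_exp der_mser_sum //; apply: ord_ge_eq => d.
have hDs : summable 0 (fun k => D (k`!%:R^-1 *: f ^+ k)).
  by move=> k k0; apply: (der_ord hD); apply: (hs (fun k => k`!%:R^-1)).
have h1 := ord_ge_le (leqnSn d) (mser_sum_trunc (d := d.+1) hDs).
apply: (ord_ge_trans h1); rewrite big_ltn // derZ // derX mulr0n scaler0 add0r.
rewrite big_add1 /=; apply: ord_geBC.
have -> : \sum_(0 <= i < d) D ((i.+1)`!%:R^-1 *: f ^+ i.+1) =
          D f * \sum_(0 <= i < d) i`!%:R^-1 *: f ^+ i.
  rewrite mulr_sumr; apply: eq_bigr => k _.
  rewrite derZ // derX /= -scaler_nat scalerA factS natrM invfM mulrAC mulVf ?natrS_neq0 //.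
  by rewrite mul1r mulrC mser_scaleAl mulrC.
by rewrite -mulrBr; apply/ord_geMl/mser_sum_trunc.
Qed.

(** The termwise derivative is the geometric series of 1 - f times f'; its
    truncation times f is 1 - (1 - f)^d. *)
Lemma der_mser_log f : ord_ge 1 (f - 1) -> D (mser_log f) * f = D f.
Proof.
set g := f - 1 => hg; have hs a := @summable_exp g a 1 hg.
have Dg : D g = D f by rewrite derB // der1 // subr0.
rewrite /mser_log -/g der_mser_sum //; apply: ord_ge_eq => d.
have hDs : summable 1 (fun k => D (((-1) ^+ k.+1 / k%:R) *: g ^+ k)).
  by move=> k k1; apply: (der_ord hD); apply: (hs (fun k => (-1) ^+ k.+1 / k%:R)).
have h1 := ord_ge_le (leqnSn d) (mser_sum_trunc (d := d.+1) hDs).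
have h2 : ord_ge d (f - f) by rewrite subrr; apply: ord_ge0.
apply: (ord_ge_trans (ord_geMB h1 h2)).
have -> : \sum_(1 <= k < d.+1) D (((-1) ^+ k.+1 / k%:R) *: g ^+ k) =
          D f * \sum_(k < d) (- g) ^+ k.
  rewrite big_add1 /= mulr_sumr big_mkord; apply: eq_bigr => k _.
  rewrite derZ // derX /= Dg -scaler_nat scalerA -mulrA mulVf ?natrS_neq0 // mulr1.
  rewrite mulrC mser_scaleAl mulrC; congr (_ * _).
  rewrite exprSr exprSr -!mulrA mulrNN mulr1 -signr_odd -[in RHS]mulN1r exprMn.
  rewrite -[in RHS]signr_odd mulr1; case: (odd k); rewrite ?expr1 ?expr0 ?scaleN1r ?scale1r.
    by rewrite mulN1r.
  by rewrite mul1r.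
have geo : (\sum_(k < d) (- g) ^+ k) * f = 1 - (- g) ^+ d.
  have -> : f = - (- g - 1) by rewrite opprB opprK addrC subrK.
  by rewrite mulrC mulNr -subrX1 opprB.
rewrite -mulrA geo mulrBr mulr1 addrAC subrr sub0r.
by apply/ord_geN/ord_geMl/ord_geX1/ord_geN.
Qed.

End ExpLog.

(** * The coefficients of log (sinh(x/2) / (x/2)) *)

Section Univariate.
Context {R : nzRingType}.
Implicit Types (f g : mseries 1 R).

Local Notation mn N := [multinom N | _ < 1].

Lemma mdeg_multinom1 N : mdeg (mn N) = N.
Proof. by rewrite mdegE big_ord1 mnmE. Qed.

Lemma multinom1P (M : 'X_{1..1}) : M = mn (M ord0).
Proof. by apply/mnmP => i; rewrite mnmE ord1. Qed.

Lemma scoefM_univariate f g N : scoef (f * g) (mn N) =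
  \sum_(i < N.+1) scoef f (mn i) * scoef g (mn (N - i)).
Proof.
rewrite scoefM.
have lt i : (i <= N)%N -> (mdeg (mn i) < (mdeg (mn N)).+1)%N.
  by rewrite !mdeg_multinom1 ltnS.
pose h (i : 'I_N.+1) : 'X_{1..1 < (mdeg (mn N)).+1, (mdeg (mn N)).+1} :=
  (BMultinom (lt i (ltn_ord i)), BMultinom (lt (N - i)%N (leq_subr i N))).
rewrite (reindex h) /=.
  apply: eq_bigl => i; apply/eqP/mnmP => a.
  by rewrite mnmDE !mnmE subnKC // -ltnS.
exists (fun k : 'X_{1..1 < (mdeg (mn N)).+1, (mdeg (mn N)).+1} =>
  inord ((k.1 : 'X_{1..1}) ord0)) => [i _|[k1 k2]] /=.
  by rewrite mnmE inord_val.
rewrite inE => /eqP /mnmP /(_ ord0); rewrite mnmDE mnmE /= => eN.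
have lek : (k1 ord0 < N.+1)%N by have := leq_addr (k2 ord0) (k1 ord0); rewrite -eN.
congr (_, _); apply: val_inj; rewrite /= [RHS]multinom1P inordK //.
by apply/mnmP => i; rewrite !mnmE; have := addKn (k1 ord0) (k2 ord0); rewrite -eN.
Qed.

Lemma scoef_mser_polyXn k N :
  scoef ((mser_poly 'X_ord0 : mseries 1 R) ^+ k) (mn N) = (N == k)%:R.
Proof.
rewrite -rmorphXn mpolyXn /= mcoeffX eq_sym; congr (nat_of_bool _)%:R.
apply/eqP/eqP => [/mnmP/(_ ord0)|->].
  by rewrite mulmnE mnm1E eqxx mul1n mnmE.
by apply/mnmP => i; rewrite ord1 mulmnE mnm1E eqxx mul1n mnmE.
Qed.

(** Meant for Cauchy products in an even degree with the even series
    sinh(x/2)/(x/2), whose vanishing coefficients kill the odd terms. *)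
Lemma sum_even_terms (V : nmodType) (F : nat -> V) k :
  (forall i, odd i -> F i = 0) ->
  \sum_(i < k.*2.+1) F i = \sum_(i < k.+1) F i.*2.
Proof.
move=> F0; rewrite -(big_mkord xpredT) -(big_mkord xpredT (fun i => F i.*2)).
elim: k => [|k IH]; first by rewrite !big_nat1.
rewrite doubleS big_nat_recr //= big_nat_recr //= IH [RHS]big_nat_recr //=.
by rewrite F0 ?addr0 ?doubleS //= odd_double.
Qed.

End Univariate.

Section SinhcLog.

Local Notation mn N := [multinom N | _ < 1].

Lemma scoef_sinhc N :
  scoef sinhc (mn N) = if odd N then 0 else sinhc_coef rat N./2.
Proof.
rewrite /= mdeg_multinom1 big_mkord.
under eq_bigr => k _ do rewrite scoef_mser_polyXn.
case: ifP => oN.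
  rewrite big1 // => k _; case: eqP => [eN|]; last by rewrite mulr0.
  by have := odd_double k; rewrite -eN oN.
have hN : (N./2 < N.+1)%N by rewrite ltnS leq_half_double -addnn leqW ?leq_addr.
have eN := odd_double_half N; rewrite oN add0n in eN.
rewrite (bigD1 (Ordinal hN)) //= eN eqxx mulr1 big1 ?addr0 // => k nk.
case: eqP => [ek|]; last by rewrite mulr0.
by case/eqP: nk; apply: val_inj => /=; have := doubleK k; rewrite -ek.
Qed.

Lemma sinhc_ord : ord_ge 1 (sinhc - 1).
Proof.
apply/ord_ge1P; rewrite scoefD scoefN scoef1 eqxx.
have -> : 0%MM = mn 0 by apply/mnmP => i; rewrite !mnmE.
by rewrite scoef_sinhc /= /sinhc_coef expn0 mul1n invr1 subrr.
Qed.

(** Comparing coefficients of A^(2k) in the Euler-derivative identity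
    s . E(log s) = E(s) for s = sinh(A/2) / (A/2). *)
Lemma sinhc_log_coef k : sinhc_coef rat k *+ k.*2 =
  \sum_(i < k.+1) sinhc_coef rat i * ((4%:R * c2 (k - i)) *+ (k - i).*2).
Proof.
have e := der_mser_log (Num.Theory.pchar_num rat)
  (euler_derivation (n := 1) (R := rat)) sinhc_ord.
transitivity (scoef (euler sinhc) (mn k.*2)).
  by rewrite scoef_euler scoef_sinhc mdeg_multinom1 odd_double doubleK.
rewrite -e mulrC scoefM_univariate.
rewrite (@sum_even_terms _ (fun i => scoef sinhc (mn i) *
   scoef (euler (mser_log sinhc)) (mn (k.*2 - i)))); last first.
  by move=> i oi; rewrite scoef_sinhc oi mul0r.
apply: eq_bigr => i _; rewrite scoef_sinhc odd_double doubleK -doubleB; congr (_ * _).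
by rewrite scoef_euler mdeg_multinom1 /c2 mulrA mulfV // mul1r.
Qed.

End SinhcLog.

Section RatEmbedding.
Context {K : fieldType} (charK0 : [pchar K] =i pred0).

Lemma intr_neq0 (z : int) : z != 0 -> (z%:~R : K) != 0.
Proof.
by case: z => [[|k]|k] // _; rewrite ?NegzE ?mulrNz ?oppr_eq0 -pmulrn natrS_neq0.
Qed.

(** [ratr] is computed from the reduced fraction; that any fraction gives the
    same value makes it a ring morphism into K, which need not be ordered. *)
Lemma ratr_frac (a b : int) : b != 0 ->
  ratr (a%:~R / b%:~R) = a%:~R / b%:~R :> K.
Proof.
move=> b0; set x : rat := _ / _.
have hx : numq x * b = a * denq x.
  apply: (intr_inj (R := rat)); rewrite !intrM.
  have <- : x * (denq x)%:~R = (numq x)%:~R by rewrite -{1}[x]divq_num_den mulfVK ?intr_eq0.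
  by rewrite mulrAC /x mulfVK ?intr_eq0.
apply/eqP; rewrite /ratr eqr_div ?intr_neq0 ?denq_neq0 //.
by rewrite -!intrM hx.
Qed.

Lemma ratr_zmod_morphism : zmod_morphism (@ratr K).
Proof.
move=> x y; rewrite -[x]divq_num_den -[y]divq_num_den.
rewrite -mulNr -mulrNz addf_div ?intr_eq0 ?denq_neq0 // -!intrM -intrD.
rewrite !ratr_frac ?mulf_neq0 ?denq_neq0 // intrD !intrM mulrNz.
by rewrite -mulNr addf_div ?intr_neq0 ?denq_neq0.
Qed.

Lemma ratr_monoid_morphism : monoid_morphism (@ratr K).
Proof.
split=> [|x y]; first by rewrite (ratr_int K 1).
rewrite -[x]divq_num_den -[y]divq_num_den.
rewrite mulf_div -!intrM !ratr_frac ?mulf_neq0 ?denq_neq0 // !intrM.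
by rewrite mulf_div.
Qed.

Lemma ratr_sinhc k : ratr (sinhc_coef rat k) = sinhc_coef K k.
Proof.
rewrite /sinhc_coef; have : (4 ^ k * (k.*2.+1)`! != 0)%N.
  by rewrite -lt0n muln_gt0 expn_gt0 fact_gt0.
move: (4 ^ k * _)%N => N N0; have := @ratr_frac 1 N N0.
by rewrite !div1r.
Qed.

Lemma sinhc_log_coef_field k : sinhc_coef K k *+ k.*2 =
  \sum_(i < k.+1) sinhc_coef K i * ((4%:R * ratr (c2 (k - i))) *+ (k - i).*2).
Proof.
pose rr : {rmorphism rat -> K} := HB.pack (@ratr K)
  (GRing.isZmodMorphism.Build rat K (@ratr K) ratr_zmod_morphism)
  (GRing.isMonoidMorphism.Build rat K (@ratr K) ratr_monoid_morphism).
have /(congr1 rr) := sinhc_log_coef k.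
rewrite rmorphMn rmorph_sum /= ratr_sinhc => ->; apply: eq_bigr => i _.
rewrite -[ratr _]/(rr _) rmorphM rmorphMn rmorphM rmorph_nat /=.
by rewrite ratr_sinhc.
Qed.

End RatEmbedding.

(** * The determinant of sinh(A/2) / (A/2) *)

Lemma sum_nat_triangle (V : nmodType) (G : nat -> nat -> V) d :
  \sum_(0 <= k < d) \sum_(i < k.+1) G i (k - i)%N =
  \sum_(0 <= p < d) \sum_(0 <= q < d - p) G p q.
Proof.
elim: d => [|d IH]; first by rewrite !big_geq.
rewrite big_nat_recr //= IH.
transitivity (\sum_(0 <= p < d.+1)
    (\sum_(0 <= q < d - p) G p q + G p (d - p)%N)); last first.
  by apply: eq_big_nat => p /andP[_ pd]; rewrite subSn // big_nat_recr.
rewrite big_split /= [X in _ = X + _]big_nat_recr //= subnn [X in _ + X + _]big_geq // addr0.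
by rewrite (big_mkord xpredT (fun i => G i (d - i)%N)).
Qed.

Section Determinant.
Context {n : nat} {K : fieldType}.
Context (D : mseries n K -> mseries n K) (hD : graded_derivation D).

Lemma map_der_mulmx p q r (A : 'M[mseries n K]_(p, q)) (B : 'M[mseries n K]_(q, r)) :
  map_mx D (A *m B) = map_mx D A *m B + A *m map_mx D B.
Proof.
apply/matrixP => i k; rewrite !mxE der_sum // -big_split /=.
by apply: eq_bigr => l _; rewrite !mxE der_leibniz.
Qed.

Lemma map_der1 m : map_mx D (1%:M : 'M_m) = 0.
Proof.
by apply/matrixP => i k; rewrite !mxE; case: eqP => _; rewrite ?der1 ?der0.
Qed.

Lemma der_prod (I : eqType) (r : seq I) (F : I -> mseries n K) : uniq r ->
  D (\prod_(i <- r) F i) =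
  \sum_(j <- r) \prod_(i <- r) (if i == j then D (F i) else F i).
Proof.
elim: r => [|x r IH] /=; first by rewrite !big_nil der1.
move=> /andP[xr ur]; rewrite !big_cons der_leibniz // IH // eqxx; congr (_ * _ + _).
  rewrite [LHS]big_seq [RHS]big_seq; apply: eq_bigr => i ir.
  by case: eqP ir xr => // -> ->.
rewrite mulr_sumr [LHS]big_seq [RHS]big_seq; apply: eq_bigr => j jr.
by rewrite big_cons; case: eqP jr xr => // <- ->.
Qed.

(** Jacobi's formula.  Differentiating the Leibniz expansion replaces one row
    of M at a time by its derivative; expanding the resulting determinant along
    that row gives the cofactors of M. *)
Lemma der_det m (M : 'M[mseries n K]_m) : D (\det M) = \tr (\adj M *m map_mx D M).
Proof.
pose Mr j : 'M_m := \matrix_(i, k) (if i == j then D (M i k) else M i k).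
transitivity (\sum_j \det (Mr j)).
  rewrite exchange_big /= der_sum //; apply: eq_bigr => s _.
  rewrite -mulr_sumr; have -> c : D ((-1) ^+ (s : bool) * c) = (-1) ^+ (s : bool) * D c.
    by case: (odd_perm s); rewrite ?expr1 ?expr0 ?mulN1r ?mul1r ?derN // !mul1r.
  rewrite der_prod ?index_enum_uniq //; apply: (congr1 (fun f => _ * f)); apply: eq_bigr => j _.
  by apply: eq_bigr => i _; rewrite mxE.
rewrite /mxtrace [RHS](eq_bigr (fun k => \sum_j \adj M k j * D (M j k))); last first.
  by move=> k _; rewrite mxE; apply: eq_bigr => j _; rewrite [X in _ * X = _]mxE.
rewrite [RHS]exchange_big; apply: eq_bigr => j _ /=.
rewrite (expand_det_row _ j); apply: eq_bigr => k _.
have minor_eq : row' j (col' k (Mr j)) = row' j (col' k M).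
  by apply/matrixP => a c; rewrite !mxE eq_sym (negPf (neq_lift _ _)).
by rewrite {1}/Mr mxE eqxx [\adj M k j]mxE /cofactor minor_eq mulrC.
Qed.

End Determinant.

Section EulerODE.
Context {n : nat} {K : fieldType} (charK0 : [pchar K] =i pred0).
Implicit Types (f g : mseries n K).

(** The Euler operator multiplies the component of degree k by k, so the
    equation determines each component from those of lower degree. *)
Lemma euler_ode_unique (u f g : mseries n K) : ord_ge 1 u ->
  euler f = u * f -> euler g = u * g -> ord_ge 1 (f - g) -> f = g.
Proof.
move=> hu ef eg h1; apply: ord_ge_eq; elim=> [//|[//|d] IH].
have e : euler (f - g) = u * (f - g).
  by rewrite (derB euler_derivation) ef eg mulrBr.
have := ord_geM hu IH; rewrite -e add1n => h M hM.
have := h M hM; rewrite scoef_euler; case: (posnP (mdeg M)) => [M0 _|M0].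
  by apply: h1; rewrite M0.
rewrite -mulr_natr => /eqP; rewrite mulf_eq0 -(prednK M0) => /orP[/eqP //|].
by rewrite (negPf (natrS_neq0 charK0 _)).
Qed.

End EulerODE.

Section MatrixSeries.
Context {n m : nat} {K : fieldType}.
Implicit Types (A B : 'M[mseries n K]_m) (a c : nat -> K).

Definition mx_ord_ge d B := forall i j, ord_ge d (B i j).

Lemma mx_ord_geX d B k : mx_ord_ge d B -> mx_ord_ge (d * k) (B ^+ k).
Proof.
move=> hB; elim: k => [|k IH] i j; first by rewrite muln0.
rewrite exprS mxE mulnS; apply: ord_ge_sum => l _; exact: ord_geM.
Qed.

Lemma mx_ord_geX1 B k : mx_ord_ge 1 B -> mx_ord_ge k (B ^+ k).
Proof. by move=> hB; rewrite -[k in mx_ord_ge k]mul1n; apply: mx_ord_geX. Qed.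

Lemma ord_ge_tr d B : mx_ord_ge d B -> ord_ge d (\tr B).
Proof. by move=> hB; apply: ord_ge_sum => i _; apply: hB. Qed.

(** The power series with coefficients a, evaluated at the matrix B. *)
Definition mxser a B : 'M[mseries n K]_m :=
  \matrix_(i, j) mser_sum 0 (fun k => a k *: (B ^+ k) i j).

Lemma summable_mxser a B i j : mx_ord_ge 1 B ->
  summable 0 (fun k => a k *: (B ^+ k) i j).
Proof. by move=> hB k _; apply/ord_geZ/mx_ord_geX1. Qed.

(** Modulo order d the product of the truncated sums runs over the square
    p, q < d, the truncated Cauchy product over the triangle p + q < d; the terms
    in between have order at least d. *)
Lemma mxserM a c B : mx_ord_ge 1 B ->
  mxser a B *m mxser c B = mxser (fun k => \sum_(i < k.+1) a i * c (k - i)%N) B.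
Proof.
move=> hB; apply/matrixP => i j; rewrite !mxE; apply: ord_ge_eq => d.
pose G p q := (a p * c q) *: (B ^+ (p + q)) i j.
have hG p q : ord_ge (p + q) (G p q) by apply/ord_geZ/mx_ord_geX1.
have hs := summable_mxser (fun k => \sum_(i < k.+1) a i * c (k - i)%N) i j hB.
apply: (ord_ge_trans _ (ord_geBC (mser_sum_trunc (d := d) hs))).
have -> : \sum_(0 <= k < d) (\sum_(i < k.+1) a i * c (k - i)%N) *: (B ^+ k) i j =
          \sum_(0 <= p < d) \sum_(0 <= q < d - p) G p q.
  rewrite -sum_nat_triangle; apply: eq_bigr => k _; rewrite scaler_suml.
  by apply: eq_bigr => -[l /= hl] _; rewrite /G subnKC.
have : ord_ge d (\sum_(0 <= p < d) \sum_(0 <= q < d) G p q -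
                 \sum_(0 <= p < d) \sum_(0 <= q < d - p) G p q).
  rewrite -sumrB; apply: ord_ge_sum => p _.
  rewrite (big_cat_nat (n := d - p)) ?leq_subr //= addrAC subrr add0r.
  rewrite big_seq; apply: ord_ge_sum => q; rewrite mem_index_iota leq_subLR => /andP[pq _].
  exact: ord_ge_le (hG _ _).
apply: ord_ge_trans.
have -> : \sum_(0 <= p < d) \sum_(0 <= q < d) G p q =
  \sum_l (\sum_(0 <= p < d) a p *: (B ^+ p) i l) * (\sum_(0 <= q < d) c q *: (B ^+ q) l j).
  under [RHS]eq_bigr => l _ do rewrite mulr_suml.
  rewrite [RHS]exchange_big; apply: eq_bigr => p _ /=.
  under [RHS]eq_bigr => l _ do rewrite mulr_sumr.
  rewrite [RHS]exchange_big; apply: eq_bigr => q _ /=.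
  rewrite /G exprD mxE scaler_sumr; apply: eq_bigr => l _.
  by rewrite -mser_scaleAl -mser_scaleAr scalerA.
rewrite -sumrB; apply: ord_ge_sum => l _; rewrite !mxE.
by apply: ord_geMB; apply/mser_sum_trunc/summable_mxser.
Qed.

Lemma trace_mxser a B : \tr (mxser a B) = mser_sum 0 (fun k => a k *: \tr (B ^+ k)).
Proof.
apply: mseriesP => M; rewrite scoef_sum.
under eq_bigr => i _ do rewrite mxE /=.
rewrite /= exchange_big; apply: eq_bigr => k _ /=.
by rewrite scoef_sum mulr_sumr.
Qed.

End MatrixSeries.

Section SinhcDeterminant.
Context {n m : nat} {K : fieldType} (charK0 : [pchar K] =i pred0).
Context (A : 'M[mseries n K]_m) (A_linear : forall i j, euler (A i j) = A i j).

Lemma mx_ord_linear : mx_ord_ge 1 A.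
Proof.
move=> i j; apply/ord_ge1P; have := congr1 (fun f => scoef f 0%MM) (A_linear i j).
by rewrite /= mdeg0.
Qed.

Lemma mx_ord_linear_sqr : mx_ord_ge 1 (A ^+ 2).
Proof. by move=> i j; apply: (ord_ge_le (leqnSn 1)); apply: mx_ord_geX1 mx_ord_linear _ _. Qed.

(** A^k is homogeneous of degree k. *)
Lemma map_eulerX k : map_mx euler (A ^+ k) = A ^+ k *+ k.
Proof.
elim: k => [|k IH]; first by rewrite mulr0n expr0 map_der1 //; apply: euler_derivation.
rewrite exprS map_der_mulmx; last exact: euler_derivation.
rewrite IH -[A *m _]/(A * _) mulrnAr mulrS; congr (_ *m _ + _).
by apply/matrixP => i j; rewrite mxE A_linear.
Qed.

Lemma eulerX_coef k i j : euler ((A ^+ k) i j) = (A ^+ k) i j *+ k.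
Proof. by have /matrixP/(_ i j) := map_eulerX k; rewrite mulmxnE mxE. Qed.

Definition exp_c2_trace : mseries n K :=
  mser_exp (mser_sum 1 (fun k => (2%:R * ratr (c2 k)) *: \tr (A ^+ k.*2))).

Let l := mser_sum 1 (fun k => (2%:R * ratr (c2 k)) *: \tr (A ^+ k.*2)).

Lemma summable_log_trace (a : nat -> K) b : summable b (fun k => a k *: \tr (A ^+ k.*2)).
Proof.
move=> k _; apply/ord_geZ/ord_ge_tr => i j; apply: (@ord_ge_le _ _ _ k.*2).
  by rewrite -addnn leq_addr.
exact: mx_ord_geX1 mx_ord_linear _ _.
Qed.

Lemma log_trace_ord : ord_ge 1 l.
Proof.
apply: ord_ge_mser_sum => k k1.
exact: ord_ge_le k1 (@summable_log_trace (fun k => 2%:R * ratr (c2 k)) 1 k k1).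
Qed.

Lemma sinhc_mxE : sinhc_mx A = mxser (sinhc_coef K) (A ^+ 2).
Proof.
apply/matrixP => i j; rewrite !mxE; apply: eq_mser_sum => k _.
by rewrite -exprM mul2n.
Qed.

Lemma scoef0_mser_exp (f : mseries n K) : ord_ge 1 f -> scoef (mser_exp f) 0%MM = 1.
Proof.
by move=> hf; rewrite /= mdeg0 big_nat1 expr0 scoef1 eqxx mulr1 invr1.
Qed.

(** The matrix A s'(A) / s(A), where s = sinh(x/2) / (x/2). *)
Let log_der : 'M[mseries n K]_m :=
  mxser (fun k => (4%:R * ratr (c2 k)) *+ k.*2) (A ^+ 2).

Lemma map_euler_sinhc : map_mx euler (sinhc_mx A) = sinhc_mx A *m log_der.
Proof.
rewrite sinhc_mxE /log_der mxserM; last exact: mx_ord_linear_sqr.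
apply/matrixP => i j; rewrite !mxE (der_mser_sum euler_derivation); last first.
  exact/summable_mxser/mx_ord_linear_sqr.
apply: eq_mser_sum => k _; rewrite (derZ euler_derivation) -sinhc_log_coef_field //.
have -> : euler ((A ^+ 2 ^+ k) i j) = (A ^+ k.*2) i j *+ k.*2.
  by rewrite -exprM mul2n eulerX_coef.
by rewrite -exprM mul2n -scalerMnl -scalerMnr.
Qed.

Lemma euler_log_trace : euler l *+ 2 = \tr log_der.
Proof.
rewrite /l (der_mser_sum euler_derivation); last exact: summable_log_trace.
rewrite trace_mxser [in RHS]mser_sum_recl; last first.
  move=> k _ /=; rewrite -exprM mul2n.
  exact: (@summable_log_trace (fun k => (4%:R * ratr (c2 k)) *+ k.*2) 0).
rewrite mulr0n scale0r add0r mser_sumMn; apply: eq_mser_sum => k _.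
rewrite (derZ euler_derivation) /mxtrace (der_sum euler_derivation) -exprM mul2n.
under eq_bigr => i _ do rewrite eulerX_coef.
rewrite sumrMnl -scalerMnl -scalerMnr mulrnAC; congr (_ *+ _).
by rewrite scalerMnl -mulrnAl -mulrnA.
Qed.

(** The square of [exp_c2_trace] and the determinant have constant term 1 and the
    same logarithmic Euler derivative tr (A s'(A) / s(A)), s = sinh(x/2)/(x/2). *)
Lemma exp_c2_trace_sqrt_det : mser_is_sqrt exp_c2_trace (\det (sinhc_mx A)).
Proof.
split; first exact/scoef0_mser_exp/log_trace_ord.
have hl := log_trace_ord.
have ht : ord_ge 1 (\tr log_der).
  rewrite -euler_log_trace mulr2n.
  by apply: ord_geD; apply: der_ord hl; apply: euler_derivation.
apply: (euler_ode_unique charK0 ht).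
- rewrite (derX euler_derivation) // (der_mser_exp charK0 euler_derivation) //.
  by rewrite -/l -euler_log_trace expr2 !mulrnAl mulrA.
- rewrite (der_det euler_derivation) map_euler_sinhc mulmxA mul_adj_mx.
  by rewrite mul_scalar_mx mxtraceZ mulrC.
- apply/ord_ge1P; rewrite scoefD scoefN expr2 scoefM0 scoef0_mser_exp //.
  rewrite -[scoef (\det _) _]/(const_coef _) -det_map_mx.
  have -> : map_mx const_coef (sinhc_mx A) = 1%:M; last by rewrite det1 mulr1 subrr.
  apply/matrixP => i j; rewrite !mxE /const_coef /= mdeg0 big_nat1 expr0.
  by rewrite /sinhc_coef expn0 mul1n invr1 mul1r mxE; case: eqP; rewrite ?scoef1 ?scoef0 ?eqxx.
Qed.

End SinhcDeterminant.

(** * Traces of powers as sums over closed paths *)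

Section ClosedPaths.
Context {R : comNzRingType} {m : nat}.
Implicit Types (B : 'M[R]_m) (u v : 'I_m) (s : seq 'I_m).

Fixpoint path_prod B u s v : R :=
  if s is x :: s' then B u x * path_prod B x s' v else B u v.

Lemma expmx_path_prod B n u v :
  (B ^+ n.+1) u v = \sum_(s : n.-tuple 'I_m) path_prod B u s v.
Proof.
elim: n u => [|n IH] u.
  by rewrite expr1 (big_pred1 [tuple]) // => s; symmetry; apply/eqP/tuple0.
rewrite exprS mxE.
rewrite (reindex (fun p : 'I_m * n.-tuple 'I_m => [tuple of p.1 :: p.2])) /=; last first.
  exists (fun t : n.+1.-tuple 'I_m => (thead t, [tuple of behead t])) => [[x s]|t] _ /=.
    by congr (_, _); apply: val_inj.
  by rewrite [RHS]tuple_eta; apply: val_inj.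
rewrite -(pair_bigA _ (fun x (s : n.-tuple 'I_m) => B u x * path_prod B x s v)) /=.
by apply: eq_bigr => x _; rewrite IH mulr_sumr.
Qed.

Lemma path_prodE B u s v : path_prod B u s v =
  \prod_(i < (size s).+1) B (nth u (u :: s) i) (nth v (rcons s v) i).
Proof.
elim: s u => [|x s IH] u; first by rewrite big_ord1.
rewrite [RHS]big_ord_recl /= IH; congr (_ * _); apply: eq_bigr => i _.
by congr (B _ _); apply: set_nth_default; rewrite ?size_rcons.
Qed.

(** The bound 0 < n matters: for n = 0 the sum has the single term 1, whereas
    the trace of the identity is m. *)
Lemma trace_expr B n : (0 < n)%N -> \tr (B ^+ n) =
  \sum_(k : {ffun 'I_n -> 'I_m}) \prod_(t < n) B (k t) (k (ordS t)).
Proof.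
case: n => // n _; rewrite /mxtrace.
under eq_bigr => u _ do rewrite expmx_path_prod.
rewrite pair_bigA /=.
pose h (p : 'I_m * n.-tuple 'I_m) : {ffun 'I_n.+1 -> 'I_m} :=
  [ffun t : 'I_n.+1 => nth p.1 (p.1 :: p.2) t].
rewrite [RHS](reindex h) /=; last first.
  exists (fun k : {ffun 'I_n.+1 -> 'I_m} => (k ord0, [tuple k (lift ord0 i) | i < n])).
    move=> [u s] _; rewrite /h /= ffunE /=; congr (_, _); apply: eq_from_tnth => i.
    by rewrite tnth_mktuple ffunE /= (tnth_nth u).
  move=> k _; apply/ffunP => t; rewrite ffunE /=.
  case: (unliftP ord0 t) => [i|] -> //=.
  rewrite (nth_map i) ?size_enum_ord ?add0n ?ltn_ord //.
  by rewrite [nth _ _ _](nth_ord_enum i i).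
apply: eq_bigr => -[u s] _; rewrite path_prodE /=.
rewrite size_tuple; apply: eq_bigr => t _; rewrite !ffunE /=; congr (B _ _).
rewrite nth_rcons size_tuple.
case: (ltngtP t n) => [tn|tn|tn]; first by rewrite modn_small ?ltnS.
  by have := ltn_ord t; rewrite ltnS leqNgt tn.
by rewrite tn modnn.
Qed.

Lemma trmxX B n : (B ^+ n)^T = B^T ^+ n.
Proof.
elim: n => [|n IH]; first by rewrite !expr0 trmx1.
by rewrite exprS exprSr -IH; apply: trmx_mul.
Qed.

End ClosedPaths.

Section TraceFormula.
Context {K : fieldType} {g : vectType K} (br : g -> g -> g).
Context (br_lie : is_lie_bracket br) {m : nat} (b : m.-tuple g).

Lemma lie_antisym x y : br x y = - br y x.
Proof.
have [linr linl alt _] := br_lie.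
have addl u v w : br (u + v) w = br u w + br v w.
  by have := linl w 1 u v; rewrite !scale1r.
have addr u v w : br w (u + v) = br w u + br w v.
  by have := linr w 1 u v; rewrite !scale1r.
apply/eqP; rewrite -addr_eq0; apply/eqP.
by have := alt (x + y); rewrite addl !addr !alt add0r addr0.
Qed.

(** The structure constants in W have their matrix indices transposed and in
    the opposite bracket order; transposition preserves the trace, and the sign
    disappears because the exponent is even. *)
Lemma W_trace n : (0 < n)%N -> W br b n = \tr (ad_mx br b ^+ n.*2).
Proof.
move=> n0; pose C : 'M[{mpoly K[m]}]_m :=
  \matrix_(i, j) \sum_e struct_const br b i e j *: 'X_e.
have -> : ad_mx br b = - C^T.
  apply/matrixP => i j; rewrite !mxE -sumrN; apply: eq_bigr => e _.
  by rewrite -scaleNr /struct_const lie_antisym linearN.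
rewrite -mul2n exprM sqrrN -exprM mul2n -trmxX mxtrace_tr trace_expr ?double_gt0 //.
apply: eq_bigr => k _.
under [RHS]eq_bigr => t _ do rewrite mxE.
rewrite bigA_distr_bigA; apply: eq_bigr => e _.
by rewrite scaler_prod.
Qed.

End TraceFormula.

(** * Pairing with exp(iota) is symmetrization *)

(** A range of indices independent of M, so that sums over M can be exchanged
    with the sum over the splittings of M. *)
Lemma scoefM_widen {n} {R : nzRingType} (f g : mseries n R) M d : (mdeg M < d)%N ->
  scoef (f * g) M =
  \sum_(k : 'X_{1..n < d, d} | M == (k.1 + k.2)%MM) scoef f k.1 * scoef g k.2.
Proof.
move=> hM; have := ord_geMB (@mser_truncP n R d f) (@mser_truncP n R d g).
move/(_ M hM)/eqP; rewrite scoefD scoefN subr_eq0 => /eqP ->.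
rewrite -rmorphM /= -[LHS]/((mpoly_mul _ _)@_M) (mcoeff_poly_mul _ _ hM).
have tE (h : mseries n R) k : (mdeg k < d)%N -> (mser_trunc d h)@_k = scoef h k.
  move=> hk; apply/eqP; rewrite eq_sym -subr_eq0; apply/eqP.
  exact: (@mser_truncP n R d h k hk).
by apply: eq_bigr => -[[k1 h1] [k2 h2]] _ /=; rewrite !tE.
Qed.

Section Symmetrization.
Context {K : fieldType}.
Context {g : vectType K} {m : nat} (b : m.-tuple g).
Context {U : algType K} (j : {linear g -> U}).

Lemma count_word d (w : 'I_d -> 'I_m) a :
  count_mem a [tuple w t | t < d] = (\sum_t U_(w t))%MM a.
Proof.
rewrite mnm_sumE -sum1_count big_tuple big_mkcond; apply: eq_bigr => t _.
by rewrite tnth_mktuple mnm1E /=; case: (w t == a).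
Qed.

(** Each word with content al is a rearrangement of the sorted word of al, in
    exactly al! ways. *)
Lemma sum_perm_mword (y : 'I_m -> U) (al : 'X_{1..m}) :
  \sum_(s : 'S_(mdeg al)) \prod_(t < mdeg al) y (tnth (mword al) (s t)) =
  mfact al *: \sum_(w : {ffun 'I_(mdeg al) -> 'I_m} | (\sum_t U_(w t))%MM == al)
    \prod_t y (w t) :> U.
Proof.
pose h (s : 'S_(mdeg al)) : {ffun 'I_(mdeg al) -> 'I_m} :=
  [ffun t => tnth (mword al) (s t)].
rewrite (partition_big h xpredT) //= [in RHS]big_mkcond scaler_sumr.
apply: eq_bigr => w _.
transitivity ((\sum_(s | h s == w) 1 : K) *: \prod_t y (w t)).
  rewrite scaler_suml; apply: eq_bigr => s /eqP <-; rewrite scale1r.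
  by apply: eq_bigr => t _; rewrite ffunE.
have -> : \sum_(s | h s == w) 1 =
    \sum_(p : 'S_(mdeg al)) \prod_(i < mdeg al)
      (onth [tuple w t | t < mdeg al] i == onth (mword al) (p i))%:R :> K.
  rewrite big_mkcond; apply: eq_bigr => s _.
  have onthE (u : (mdeg al).-tuple 'I_m) (i : 'I_(mdeg al)) : onth u i = Some (tnth u i).
    by rewrite onthE (nth_map (tnth u i)) ?size_tuple // -tnth_nth.
  under eq_bigr => i _ do rewrite !onthE tnth_mktuple.
  case: eqP => [<-|ne].
    by rewrite big1 // => i _; rewrite ffunE eqxx.
  have /existsP[t nt] : [exists t, tnth (mword al) (s t) != w t].
    rewrite -negb_forall; apply/forallP => all_eq; apply: ne; apply/ffunP => t.
    by rewrite ffunE; apply/eqP.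
  rewrite (bigD1 t) //= -[Some _ == Some _]/(w t == _) eq_sym (negPf nt).
  by rewrite mul0r.
rewrite sum_perm_onth //; case: eqP => [e|ne].
  have cnt a : count_mem a [tuple w t | t < mdeg al] = al a by rewrite count_word e.
  have -> : [forall a, count_mem a [tuple w t | t < mdeg al] == count_mem a (mword al)].
    by apply/forallP => a; rewrite count_mword cnt.
  by rewrite mul1n; congr (_%:R *: _); apply: eq_bigr => a _; rewrite cnt.
case: forallP => [all_eq|_]; last by rewrite mul0n scale0r scaler0.
case: ne; apply/mnmP => a; rewrite -count_word -[RHS]count_mword.
exact/eqP/all_eq.
Qed.

(** The symmetrization of the monomial with exponents al. *)
Definition sym_mono (al : 'X_{1..m}) : U :=
  (mdeg al)`!%:R^-1 *: \sum_(s : 'S_(mdeg al)) \prod_(t < mdeg al)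
    j (tnth b (tnth (mword al) (s t))).

Lemma prod_scale_mono d (c : 'I_d -> U) (M : 'I_d -> 'X_{1..m}) (r : seq 'I_d) :
  \prod_(t <- r) (c t *: 'X_[M t]) =
  (\prod_(t <- r) c t) *: 'X_[\sum_(t <- r) M t] :> {mpoly U[m]}.
Proof.
elim: r => [|t r IH]; first by rewrite !big_nil scale1r mpolyX0.
rewrite !big_cons IH -scalerAl -commr_mpolyX -scalerAl scalerA -mpolyXD.
by rewrite addmC.
Qed.

(** The coefficients of iota lie in U, so the words keep the order of their
    letters while the monomials only record the content. *)
Lemma scoef_iota_exp k (al : 'X_{1..m}) : scoef (iota_elt b j ^+ k) al =
  \sum_(w : {ffun 'I_k -> 'I_m} | (\sum_t U_(w t))%MM == al) \prod_t j (tnth b (w t)).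
Proof.
rewrite /iota_elt -rmorphXn /= -[k in LHS]card_ord -prodr_const bigA_distr_bigA.
rewrite raddf_sum [RHS]big_mkcond; apply: eq_bigr => w _ /=.
rewrite prod_scale_mono mcoeffZ mcoeffX.
by case: eqP => _; rewrite ?mulr1 ?mulr0.
Qed.

Lemma exp_iota_coef al : mfact al *: scoef (exp_iota b j) al = sym_mono al.
Proof.
rewrite /exp_iota /= big_nat_recr //= big_nat big1 => [|k /= kd].
  rewrite add0r /sym_mono (sum_perm_mword (fun i => j (tnth b i))) scoef_iota_exp.
  by rewrite mulr_algl !scalerA mulrC.
rewrite scoef_iota_exp big1 ?mulr0 // => w /eqP e.
move: kd; rewrite -e mdeg_sum /=.
by under eq_bigr => t _ do rewrite mdeg1; rewrite sum1_card card_ord ltnn.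
Qed.

Lemma symmetrizationE d (Q : {mpoly K[m]}) :
  (forall M, M \in msupp Q -> (mdeg M < d)%N) ->
  symmetrization b j Q = \sum_(be : 'X_{1..m < d}) Q@_be *: sym_mono be.
Proof.
move=> hQ; rewrite /symmetrization (big_mksub 'X_{1..m < d}) //= ?msupp_uniq //.
rewrite big_mkcond; apply: eq_bigr => be _.
by case: ifPn => // /memN_msupp_eq0 ->; rewrite scale0r.
Qed.

Lemma mfactD (al be : 'X_{1..m}) :
  mfact (al + be) = mfact be * (\prod_(i < m) (al + be)%MM i ^_ al i)%:R :> K.
Proof.
rewrite /mfact -natrM -big_split /=; congr (_%:R); apply: eq_bigr => i _.
by rewrite mnmDE -(ffact_fact (leq_addr (be i) (al i))) addKn mulnC.
Qed.

(** Both sides are the sum over pairs (al, be) of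
    (al + be)! P_(al + be) f_al times the coefficient of exp(iota) at be. *)
Lemma tensor_pairing_exp_iota (f : mseries m K) P :
  tensor_pairing (exp_iota b j * mser_tensor1 f) P =
  symmetrization b j (diff_op f P).
Proof.
set d := msize P; pose H (be al : 'X_{1..m}) : U :=
  (P@_(be + al) * mfact (be + al) * scoef f al) *: scoef (exp_iota b j) be.
have P0 M : (d <= mdeg M)%N -> P@_M = 0.
  by move=> h; apply/memN_msupp_eq0/msize_mdeg_ge.
transitivity (\sum_(k : 'X_{1..m < d, d}) H k.1 k.2).
  rewrite /tensor_pairing -/d.
  under eq_bigr => ga _.
    rewrite (scoefM_widen _ _ (bmdeg ga)) scaler_sumr.
    over.
  rewrite /= (exchange_big_dep xpredT) //=; apply: eq_bigr => -[k1 k2] _ /=.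
  transitivity (\sum_(ga : 'X_{1..m < d} | val ga == (k1 + k2)%MM) H k1 k2).
    apply: eq_bigr => ga /eqP e; rewrite e pairing_mono /H mulr_algr scalerA.
    by [].
  case: (ltnP (mdeg (k1 + k2)%MM) d) => hd.
    by rewrite (big_pred1 (BMultinom hd)).
  have -> : H k1 k2 = 0 by rewrite /H P0 // !mul0r scale0r.
  by rewrite big1.
have cE be : (diff_op f P)@_be = \sum_(al : 'X_{1..m < d})
    scoef f al * (P@_(al + be) *+ \prod_(i < m) (al + be)%MM i ^_ al i).
  by rewrite /diff_op raddf_sum; apply: eq_bigr => al _; rewrite /= mcoeffZ mcoeff_mderivm.
rewrite (@symmetrizationE d) => [|M]; last first.
  rewrite mcoeff_msupp ltnNge; apply: contraNN => hM; rewrite cE big1 // => al _.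
  by rewrite P0 ?mul0rn ?mulr0 // mdegD (leq_trans hM) // leq_addl.
rewrite -(pair_bigA _ (fun be al : 'X_{1..m < d} => H be al)) /=.
apply: eq_bigr => be _; rewrite cE scaler_suml; apply: eq_bigr => al _.
rewrite -exp_iota_coef scalerA /H; congr (_ *: _).
rewrite [(be + al)%MM]addmC mfactD -[_ *+ _ in RHS]mulr_natr mulrC !mulrA.
by rewrite [RHS]mulrAC.
Qed.

End Symmetrization.

(** * Invariance under the coadjoint action *)

Lemma mderivXU {n} {R : nzRingType} (i e : 'I_n) :
  ('X_e : {mpoly R[n]})^`M(i) = (i == e)%:R.
Proof.
rewrite mderivX mnm1E eq_sym; case: eqP => [->|_]; last exact: scale0r.
rewrite scale1r -[RHS]mpolyX0; congr 'X_[_].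
by apply/mnmP => a; rewrite mnmBE subnn mnmE.
Qed.

Section Constants.
Context {n : nat} {R : nzRingType}.
Implicit Types (f : mseries n R) (c : R).

Definition mser_const c : mseries n R := c *: (1 : mseries n R).

Lemma mser_constMl c f : mser_const c * f = c *: f.
Proof. by rewrite /mser_const -mser_scaleAl mul1r. Qed.

Lemma scoef_mser_constMr c f M : scoef (f * mser_const c) M = scoef f M * c.
Proof.
rewrite -{2}[f]mulr1 !scoefM mulr_suml; apply: eq_bigr => k _.
rewrite scoefZ !scoef1 -mulrA; congr (_ * _).
by case: (_ == _); rewrite ?mulr1 ?mul1r ?mulr0 ?mul0r.
Qed.

End Constants.

Section Tensor.
Context {n : nat} {K : fieldType} {U : algType K}.
Implicit Types (f g : mseries n K) (F G : mseries n U).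

Local Notation T f := (mser_tensor1 f : mseries n U).

Lemma tensor1D f g : T (f + g) = T f + T g.
Proof. by apply: mseriesP => M; rewrite scoefD /= scalerDl. Qed.

Lemma tensor10 : T 0 = 0.
Proof. apply: mseriesP => M; rewrite scoef0 -[LHS]/((scoef 0 M)%:A) scoef0. exact: scale0r. Qed.

Lemma tensor1M f g : T (f * g) = T f * T g.
Proof.
apply: mseriesP => M; rewrite scoefM -[LHS]/((scoef (f * g) M)%:A) scoefM scaler_suml.
by apply: eq_bigr => k _; rewrite /= mulr_algl scalerA.
Qed.

Lemma tensor1_pderiv i f : pderiv i (T f) = T (pderiv i f).
Proof. by apply: mseriesP => M; rewrite /= scalerMnl. Qed.

Lemma tensor1_comm f F : GRing.comm (T f) F.
Proof.
apply: mseriesP => M; rewrite !scoefM.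
pose swap (X : Type) (k : X * X) := (k.2, k.1).
have swapK X : involutive (@swap X) by case.
rewrite (reindex_inj (inv_inj (swapK _))) /=.
apply: eq_big => k; rewrite ?[(k.2 + k.1)%MM]addmC // => _.
by rewrite mulr_algl mulr_algr.
Qed.

Context (l : 'I_n -> mseries n K).

Lemma tensor1_linear_der f : linear_der (fun i => T (l i)) (T f) = T (linear_der l f).
Proof.
rewrite /linear_der (big_morph (fun f => T f) tensor1D tensor10).
by apply: eq_bigr => i _; rewrite tensor1_pderiv tensor1M.
Qed.

Context (l1 : forall i, ord_ge 1 (l i)).

Lemma tensor1_linear_der_derivation :
  graded_derivation (linear_der (fun i => T (l i))).
Proof.
apply: linear_der_derivation => [i M hM|i F]; last exact: tensor1_comm.
by rewrite /= l1 // scale0r.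
Qed.

End Tensor.

Section Coadjoint.
Context {K : fieldType} (charK0 : [pchar K] =i pred0).
Context {g : vectType K} {br : g -> g -> g} (br_lie : is_lie_bracket br).
Context {m : nat} {b : m.-tuple g} (b_basis : basis_of fullv b).
Context {U : algType K} {j : {linear g -> U}} (j_lie : is_lie_to_alg br j).

Definition ad_ser : 'M[mseries m K]_m := map_mx (@mser_poly m K) (ad_mx br b).

Lemma ad_serE i l : ad_ser i l =
  \sum_k coord b i (br (tnth b k) (tnth b l)) *: mser_poly 'X_k.
Proof.
by rewrite mxE mxE rmorph_sum; apply: eq_bigr => k _; rewrite /= mser_polyZ.
Qed.

Section Direction.
Context (x : g).

(** The coadjoint action of x on b_i^*, as a linear form. *)
Definition coad_coef (i : 'I_m) : mseries m K :=
  mser_poly (\sum_(k < m) (- coord b i (br x (tnth b k))) *: 'X_k).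

Lemma coad_coef_ord i : ord_ge 1 (coad_coef i).
Proof.
apply/ord_ge1P; rewrite /= raddf_sum /= big1 // => k _.
by rewrite mcoeffZ mcoeffX mnm1_eq0 mulr0.
Qed.

Definition coad_ser : mseries m K -> mseries m K := linear_der coad_coef.
Definition coad_ser_tensor : mseries m U -> mseries m U :=
  linear_der (fun i => mser_tensor1 (coad_coef i)).

Lemma coad_ser_derivation : graded_derivation coad_ser.
Proof. exact: (linear_der_derivation coad_coef_ord (fun i f => mulrC _ _)). Qed.

Lemma coad_ser_tensor_derivation : graded_derivation coad_ser_tensor.
Proof. exact/tensor1_linear_der_derivation/coad_coef_ord. Qed.

Lemma coad_ser_poly f : coad_ser (mser_poly f) = mser_poly (coad_act br b x f).
Proof.
rewrite /coad_ser /linear_der /coad_act rmorph_sum; apply: eq_bigr => i _ /=.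
by rewrite rmorphM pderiv_poly.
Qed.

Lemma coord_sum y : y = \sum_i coord b i y *: tnth b i.
Proof.
rewrite {1}(coord_basis b_basis (memvf y)); apply: eq_bigr => i _.
by rewrite (tnth_nth 0).
Qed.

Lemma br_suml I (r : seq I) (F : I -> g) (c : I -> K) z :
  br (\sum_(i <- r) c i *: F i) z = \sum_(i <- r) c i *: br (F i) z.
Proof.
elim: r => [|i r IH]; last by rewrite !big_cons (lie_linearl br_lie) IH.
rewrite !big_nil; have := lie_linearl br_lie z (-1) 0 0.
by rewrite !scaleN1r oppr0 addr0 addNr.
Qed.

Lemma br_sumr I (r : seq I) (F : I -> g) (c : I -> K) z :
  br z (\sum_(i <- r) c i *: F i) = \sum_(i <- r) c i *: br z (F i).
Proof.
rewrite (lie_antisym br_lie) br_suml -sumrN; apply: eq_bigr => i _.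
by rewrite (lie_antisym br_lie z) scalerN.
Qed.

Lemma br_derivation y z : br x (br y z) = br (br x y) z + br y (br x z).
Proof.
have := lie_jacobi br_lie x y z; move/eqP; rewrite -addrA addr_eq0 => /eqP ->.
rewrite opprD addrC; congr (_ + _); first by rewrite -(lie_antisym br_lie).
rewrite (lie_antisym br_lie z x).
have := br_sumr [:: tt] (fun _ => br x z) (fun _ => -1) y.
by rewrite !big_seq1 !scaleN1r => ->; rewrite opprK.
Qed.

(** The matrix of ad_x for the fixed x. *)
Definition ad_const : 'M[mseries m K]_m :=
  \matrix_(i, k) mser_const (coord b i (br x (tnth b k))).

(** The matrix of ad_y is an invariant function of y up to conjugation: by the
    Jacobi identity the coadjoint action differentiates it to a commutator. *)
Lemma coad_ad_ser :
  map_mx coad_ser ad_ser = ad_ser *m ad_const - ad_const *m ad_ser.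
Proof.
pose X k : mseries m K := mser_poly 'X_k.
have adE i l : ad_ser i l = \sum_k coord b i (br (tnth b k) (tnth b l)) *: X k.
  exact: ad_serE.
have DX e : coad_ser (X e) = \sum_k (- coord b e (br x (tnth b k))) *: X k.
  rewrite coad_ser_poly /coad_act (bigD1 e) //= mderivXU eqxx mulr1.
  rewrite [X in _ + X]big1 ?addr0 => [|i ne]; last first.
    by rewrite mderivXU (negPf ne) mulr0.
  by rewrite rmorph_sum; apply: eq_bigr => k _; rewrite /= mser_polyZ.
apply/matrixP => i l; rewrite [LHS]mxE adE (der_sum (coad_ser_derivation)).
rewrite [RHS]mxE [X in _ + X]mxE ![(_ *m _) i l]mxE.
under eq_bigr => e _.
  rewrite (derZ coad_ser_derivation) DX scaler_sumr.
  under eq_bigr => k _ do rewrite scalerA.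
  over.
rewrite exchange_big /=.
have -> : \sum_q ad_ser i q * ad_const q l =
    \sum_k coord b i (br (tnth b k) (br x (tnth b l))) *: X k.
  transitivity (\sum_q \sum_k (coord b q (br x (tnth b l)) *
      coord b i (br (tnth b k) (tnth b q))) *: X k).
    apply: eq_bigr => q _; rewrite adE mxE mulrC mser_constMl scaler_sumr.
    by apply: eq_bigr => k _; rewrite scalerA.
  rewrite exchange_big; apply: eq_bigr => k _ /=; rewrite -scaler_suml; congr (_ *: _).
  rewrite [in RHS](coord_sum (br x (tnth b l))) br_sumr linear_sum.
  by apply: eq_bigr => q _; rewrite linearZ.
have -> : \sum_q ad_const i q * ad_ser q l =
    \sum_k coord b i (br x (br (tnth b k) (tnth b l))) *: X k.
  transitivity (\sum_q \sum_k (coord b q (br (tnth b k) (tnth b l)) *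
      coord b i (br x (tnth b q))) *: X k).
    apply: eq_bigr => q _; rewrite adE mxE mser_constMl scaler_sumr.
    by apply: eq_bigr => k _; rewrite scalerA mulrC.
  rewrite exchange_big; apply: eq_bigr => k _ /=; rewrite -scaler_suml; congr (_ *: _).
  rewrite [in RHS](coord_sum (br (tnth b k) (tnth b l))) br_sumr linear_sum.
  by apply: eq_bigr => q _; rewrite linearZ.
rewrite -sumrB; apply: eq_bigr => k _; rewrite -scaler_suml -scalerBl; congr (_ *: _).
rewrite br_derivation linearD /= opprD addrCA subrr addr0.
rewrite [in RHS](coord_sum (br x (tnth b k))) br_suml linear_sum -sumrN; apply: eq_bigr => e _.
by rewrite linearZ /= mulrN mulrC.
Qed.

Lemma coad_ad_serX k :
  map_mx coad_ser (ad_ser ^+ k) = ad_ser ^+ k *m ad_const - ad_const *m ad_ser ^+ k.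
Proof.
elim: k => [|k IH].
  by rewrite expr0 (map_der1 coad_ser_derivation) mulmx1 mul1mx subrr.
rewrite exprS -[_ * _]/(_ *m _) (map_der_mulmx coad_ser_derivation) IH coad_ad_ser.
by rewrite mulmxBl mulmxBr !mulmxA addrC addrA subrK.
Qed.

Lemma coad_ad_trace k : coad_ser (\tr (ad_ser ^+ k)) = 0.
Proof.
have -> : coad_ser (\tr (ad_ser ^+ k)) = \tr (map_mx coad_ser (ad_ser ^+ k)).
  by rewrite (der_sum coad_ser_derivation); apply: eq_bigr => i _; rewrite mxE.
by rewrite coad_ad_serX linearB /= mxtrace_mulC subrr.
Qed.

End Direction.

Lemma ad_ser_linear i k : euler (ad_ser i k) = ad_ser i k.
Proof.
rewrite ad_serE (der_sum euler_derivation); apply: eq_bigr => e _.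
rewrite (derZ euler_derivation); congr (_ *: _); apply: mseriesP => M.
rewrite scoef_euler /mser_poly; have := mcoeffX K U_(e) M => /= ->.
by case: eqP => [<-|_]; rewrite ?mdeg1 ?mul0rn.
Qed.

Lemma mser_poly_trace k : mser_poly (\tr (ad_mx br b ^+ k)) = \tr (ad_ser ^+ k).
Proof.
rewrite -[LHS](trace_map_mx (@mser_poly m K)); congr (\tr _).
elim: k => [|k IH]; first by rewrite !expr0 map_mx1.
by rewrite !exprS -IH; apply: (map_mxM (@mser_poly m K)).
Qed.

Lemma Omega_trace : Omega br b =
  mser_exp (mser_sum 1 (fun k =>
    (2%:R * ratr (c2 k)) *: mser_poly (\tr (ad_mx br b ^+ k.*2)))).
Proof.
rewrite /Omega; congr mser_exp; apply: eq_mser_sum => k k1.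
by rewrite (W_trace br_lie).
Qed.

Lemma Omega_exp_c2_trace : Omega br b = exp_c2_trace ad_ser.
Proof.
rewrite Omega_trace /exp_c2_trace; congr mser_exp; apply: eq_mser_sum => k _.
by rewrite mser_poly_trace.
Qed.

(** Omega is the exponential of a combination of invariant traces. *)
Lemma coad_Omega x : coad_ser x (Omega br b) = 0.
Proof.
have hD := coad_ser_derivation x.
rewrite Omega_exp_c2_trace (der_mser_exp charK0 hD); last exact: log_trace_ord ad_ser_linear.
rewrite (der_mser_sum hD); last first.
  exact: (summable_log_trace ad_ser_linear (fun k => 2%:R * ratr (c2 k))).
have -> : mser_sum 1 (fun k => coad_ser x ((2%:R * ratr (c2 k)) *: \tr (ad_ser ^+ k.*2))) = 0.
  apply: mseriesP => M; rewrite scoef0 /= big1 // => k _.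
  by rewrite (derZ hD) coad_ad_trace scoefZ scoef0 mulr0.
by rewrite mul0r.
Qed.

Section Commutator.
Context (x : g).
Let jx : mseries m U := mser_const (j x).

Lemma coad_iota : coad_ser_tensor x (iota_elt b j) = iota_elt b j * jx - jx * iota_elt b j.
Proof.
have jlie y : j y * j x - j x * j y = - j (br x y) by rewrite j_lie opprB.
have iotaE M : scoef (iota_elt b j) M = \sum_k j (tnth b k) * (U_(k)%MM == M)%:R.
  by rewrite /= raddf_sum; apply: eq_bigr => k _; rewrite /= mcoeffZ mcoeffX.
apply: mseriesP => M.
rewrite scoefD scoefN mser_constMl scoefZ scoef_mser_constMr iotaE mulr_suml mulr_sumr -sumrB.
transitivity (\sum_k - j (br x (tnth b k)) * (U_(k)%MM == M)%:R); last first.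
  apply: eq_bigr => k _; rewrite -jlie mulrBl !mulrA; congr (_ - _).
  by rewrite -!mulrA; congr (_ * _); case: eqP; rewrite ?mulr1 ?mul1r ?mulr0 ?mul0r.
rewrite /coad_ser_tensor /linear_der scoef_sum.
transitivity (\sum_i \sum_k ((- coord b i (br x (tnth b k))) *: j (tnth b i))
     * (U_(k)%MM == M)%:R); last first.
  rewrite exchange_big; apply: eq_bigr => k _ /=; rewrite -mulr_suml; congr (_ * _).
  rewrite [X in j X](coord_sum (br x (tnth b k))) linear_sum -sumrN.
  by apply: eq_bigr => i _; rewrite linearZ scaleNr.
apply: eq_bigr => i _.
have -> : pderiv i (iota_elt b j) = mser_const (j (tnth b i)).
  rewrite /iota_elt pderiv_poly (raddf_sum (mderiv i)) (bigD1 i) //= big1 => [|k ne].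
    by rewrite addr0 mderivZ mderivXU eqxx mser_polyZ rmorph1.
  by rewrite mderivZ mderivXU eq_sym (negPf ne) scaler0.
rewrite scoef_mser_constMr /= raddf_sum scaler_suml mulr_suml.
apply: eq_bigr => k _; rewrite /= mcoeffZ mcoeffX mulr_algl -scalerA -!scalerAl.
by congr (_ *: _); case: eqP; rewrite ?scale1r ?mulr1 ?scale0r ?mulr0 ?mul1r.
Qed.

Lemma coad_iotaX k : coad_ser_tensor x (iota_elt b j ^+ k) =
  iota_elt b j ^+ k * jx - jx * iota_elt b j ^+ k.
Proof.
have hD := coad_ser_tensor_derivation x; elim: k => [|k IH].
  by rewrite expr0 (der1 hD) mulr1 mul1r subrr.
rewrite exprS (der_leibniz hD) IH coad_iota.
by rewrite mulrBl mulrBr !mulrA addrC addrA subrK.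
Qed.

Lemma iota_ord : ord_ge 1 (iota_elt b j).
Proof.
apply/ord_ge1P; rewrite /= raddf_sum /= big1 // => k _.
by rewrite mcoeffZ mcoeffX mnm1_eq0 mulr0.
Qed.

(** exp(iota) is an invariant of the diagonal action: the coadjoint action on
    its coefficients cancels the adjoint action on U. *)
Lemma coad_exp_iota :
  coad_ser_tensor x (exp_iota b j) = exp_iota b j * jx - jx * exp_iota b j.
Proof.
have hD := coad_ser_tensor_derivation x.
have hs : summable 0 (fun k => (k`!%:R^-1)%:A *: iota_elt b j ^+ k).
  by move=> k _; apply/ord_geZ/ord_geX1/iota_ord.
rewrite /exp_iota (der_mser_sum hD) // mser_sumMr // mser_sumMl // -mser_sumB.
apply: eq_mser_sum => k _; rewrite (derZ hD) coad_iotaX scalerBr; congr (_ - _).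
  exact: mser_scaleAl.
rewrite !mser_constMl; apply: mseriesP => M; rewrite !scoefZ.
by rewrite !mulr_algl -scalerAr.
Qed.

Lemma coad_Upsilon_repr (F := exp_iota b j * mser_tensor1 (Omega br b)) :
  coad_ser_tensor x F = F * jx - jx * F.
Proof.
rewrite /F (der_leibniz (coad_ser_tensor_derivation x)) coad_exp_iota.
have -> : coad_ser_tensor x (mser_tensor1 (Omega br b)) = 0.
  by rewrite /coad_ser_tensor tensor1_linear_der -/(coad_ser x _) coad_Omega tensor10.
have comm_jx := tensor1_comm (Omega br b) jx.
by rewrite mulr0 addr0 mulrBl -[_ * jx * _]mulrA -comm_jx !mulrA.
Qed.

(** In degree d only finitely many monomials occur, and each contributes the
    coadjoint action on that monomial tensored with its coefficient. *)
Lemma coad_ser_tensor_null (F : mseries m U) : coinv_null br b (coad_ser_tensor x F).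
Proof.
have hD := coad_ser_tensor_derivation x.
apply/boolp.asboolP => d.
exists [seq (x, 'X_[(k : 'X_{1..m < d.+1})], scoef F k) |
         k : 'X_{1..m < d.+1}] => M dM.
rewrite big_map big_enum /=.
have := der_ord hD (@mser_truncP _ _ d.+1 F).
move/(_ M); rewrite dM => /(_ (ltnSn d)) /eqP.
rewrite (derB hD) scoefD scoefN subr_eq0 => /eqP ->.
rewrite /mser_trunc raddf_sum (der_sum hD) scoef_sum; apply: eq_bigr => k _ /=.
rewrite mser_polyZ (derZ hD) scoefZ.
have -> : mser_poly 'X_[k] = mser_tensor1 (mser_poly 'X_[k]) :> mseries m U.
  by apply: mseriesP => N; rewrite /= !mcoeffX; case: eqP; rewrite ?scale1r ?scale0r.
by rewrite /coad_ser_tensor tensor1_linear_der -/(coad_ser x _) coad_ser_poly /= mulr_algr.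
Qed.

End Commutator.

(** The commutator of the pairing with j x is the pairing with a series in the
    image of the coadjoint action, which is zero in the coinvariants. *)
Lemma duflo_invariant P : S_invariant br b P -> U_invariant j (duflo br b j P).
Proof.
move=> Pinv x; rewrite /duflo /Upsilon coinv_pairing_pi //.
set F := exp_iota b j * _; have := tensor_pairing_coinv Pinv (coad_ser_tensor_null x F).
rewrite coad_Upsilon_repr tensor_pairingB => /eqP; rewrite subr_eq0 => /eqP e.
apply/eqP; rewrite subr_eq0; apply/eqP.
transitivity (tensor_pairing (mser_const (j x) * F) P).
  rewrite /tensor_pairing mulr_sumr; apply: eq_bigr => al _.
  by rewrite mser_constMl scoefZ scalerAr.
rewrite -e /tensor_pairing mulr_suml; apply: eq_bigr => al _.
by rewrite scoef_mser_constMr scalerAl.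
Qed.

End Coadjoint.

Theorem mainTheorem3
    (K : fieldType) (charK0 : [pchar K] =i pred0)
    (g : vectType K) (br : g -> g -> g) (br_lie : is_lie_bracket br)
    (m : nat) (b : m.-tuple g) (b_basis : basis_of fullv b)
    (U : algType K) (j : {linear g -> U}) (jU : is_enveloping br j) :
  [/\ Omega br b =
        mser_exp (mser_sum 1 (fun n =>
          (2%:R * ratr (c2 n)) *: mser_poly (\tr (ad_mx br b ^+ n.*2)))),
      mser_is_sqrt (Omega br b)
        (\det (sinhc_mx (map_mx mser_poly (ad_mx br b))))
    & forall P : {mpoly K[m]}, S_invariant br b P ->
        U_invariant j (duflo br b j P) /\
        duflo br b j P = symmetrization b j (diff_op (Omega br b) P) ].
Proof.
split.
- exact: Omega_trace.
- rewrite Omega_exp_c2_trace //.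
  exact: (exp_c2_trace_sqrt_det charK0 ad_ser_linear).
move=> P Pinv; split; first exact: (duflo_invariant charK0 br_lie b_basis (env_lie jU)).
by rewrite /duflo /Upsilon coinv_pairing_pi // tensor_pairing_exp_iota.
Qed.
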